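(* Let $K_1$ and $K_2$ be two finite Galois extensions of $\mathbb{Q}$. Let $K_0=K_1\cap K_2$ and $L=K_1K_2$. Assume that: (a) $K_0$ is a Pólya field; (b) $\gcd([K_1:K_0],[K_2:K_0])=1$. Then $$\mathcal{P}o(L)\simeq \mathcal{P}o(K_1)\oplus\mathcal{P}o(K_2).$$ More precisely, $$\mathcal{P}o(L)=\varepsilon_{K_1}^L(\mathcal{P}o(K_1))\oplus\varepsilon_{K_2}^L(\mathcal{P}o(K_2))$$ (internal direct sum of subgroups of $\mathcal{P}o(L)$).
   Context: For a number field $K$ with ring of integers $\mathcal{O}_K$ and class group $\mathcal{C}l(K)$, and for each positive integer $q$, $\Pi_q(K)$ denotes the product of all maximal ideals of $\mathcal{O}_K$ of norm $q$ (with $\Pi_q(K)=\mathcal{O}_K$ if there is none). The Pólya group $\mathcal{P}o(K)$ is the subgroup of $\mathcal{C}l(K)$ generated by the classes of all the ideals $\Pi_q(K)$, $q\ge 1$. $K$ is a Pólya field if all the ideals $\Pi_q(K)$ are principal, i.e. if $\mathcal{P}o(K)$ is trivial. For a finite extension $L/K$ of number fields, $\varepsilon_K^L:\mathcal{C}l(K)\to\mathcal{C}l(L)$ is the homomorphism sending the class of an ideal $I$ to the class of $I\mathcal{O}_L$; when $K$ and $L$ are both Galois over $\mathbb{Q}$ it maps $\mathcal{P}o(K)$ into $\mathcal{P}o(L)$. *)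

(* Defs.v *)
From HB Require Import structures.
From mathcomp Require Import all_boot all_order all_algebra all_field.
From mathcomp Require Import finmap all_classical.

Set Implicit Arguments.
Unset Strict Implicit.
Unset Printing Implicit Defensive.

Import GRing.Theory.

Local Open Scope classical_set_scope.
Local Open Scope ring_scope.

(* Number fields are the subfields K of a finite extension N of rat, so that
   intersections and composita are available.  Ideals of K are sets of elements
   of N contained in K; nothing below depends on the choice of N. *)

Section Ideals.
Variable N : fieldExtType rat.
Implicit Types (K : {subfield N}) (I J P : set N) (a x y : N).

Definition ring_of_integers K : set N :=
  [set x | x \in K /\ integralOver (intr : int -> N) x].

(* Finite sums of products of an element of I by an element of J.  This is the
   product of ideals, and also the extension of an ideal I of K to L when
   J = ring_of_integers L. *)
Definition ideal_mul I J : set N :=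
  [set x | exists2 s : seq N,
     {in s, forall y, [set a * b | a in I & b in J] y} & x = \sum_(y <- s) y].

Definition ideal_scale a I : set N := [set a * x | x in I].

Definition submodule K I :=
  [/\ I 0, forall x y, I x -> I y -> I (x + y)
    & forall a x, ring_of_integers K a -> I x -> I (a * x)].

Definition fractional_ideal K I :=
  [/\ submodule K I, I `<=` [set x | x \in K]
    & exists d, [/\ ring_of_integers K d, d != 0
                  & ideal_scale d I `<=` ring_of_integers K]].

(* The ring of integers being Dedekind, these are exactly the nonzero
   fractional ideals. *)
Definition invertible_ideal K I :=
  fractional_ideal K I /\
  exists2 J, fractional_ideal K J & ideal_mul I J = ring_of_integers K.

Definition ideal_inv K I : set N :=
  [set x | x \in K /\ ideal_scale x I `<=` ring_of_integers K].

(* The coset of I modulo nonzero principal fractional ideals. *)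
Definition ideal_class K I : set (set N) :=
  [set ideal_scale a I | a in [set a | a \in K /\ a != 0]].

Definition integral_ideal K I := submodule K I /\ I `<=` ring_of_integers K.

Definition principal_ideal K I :=
  exists2 a, ring_of_integers K a & I = ideal_scale a (ring_of_integers K).

Definition maximal_ideal K P :=
  [/\ integral_ideal K P, P <> ring_of_integers K
    & forall I, integral_ideal K I -> P `<=` I ->
        I = P \/ I = ring_of_integers K].

Definition residue_classes K I : set (set N) :=
  [set [set y | ring_of_integers K y /\ I (y - x)]
     | x in ring_of_integers K].

Definition has_norm K I (q : nat) := (residue_classes K I #= `I_q)%card.

(* For q > 0 there are only finitely many ideals of norm q (they all
   contain q), so that fset_set does enumerate the set it is applied to. *)
Definition Pi_ideal K (q : nat) : set N :=
  \big[ideal_mul/ring_of_integers K]_(P <-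
     fset_set [set P | maximal_ideal K P /\ has_norm K P q]) P.

Definition polya_field K :=
  forall q : nat, (0 < q)%N -> principal_ideal K (Pi_ideal K q).

Lemma roi0 K : ring_of_integers K 0.
Proof. by split; [apply: mem0v | apply: integral0]. Qed.

Lemma roi1 K : ring_of_integers K 1.
Proof. by split; [apply: mem1v | apply: integral1]. Qed.

Lemma roiD K x y : ring_of_integers K x -> ring_of_integers K y ->
  ring_of_integers K (x + y).
Proof.
by move=> [Kx ix] [Ky iy]; split; [apply: memvD | apply: integral_add].
Qed.

Lemma roiM K x y : ring_of_integers K x -> ring_of_integers K y ->
  ring_of_integers K (x * y).
Proof.
by move=> [Kx ix] [Ky iy]; split; [apply: rpredM | apply: integral_mul].
Qed.

Lemma ideal_mul0 I J : ideal_mul I J 0.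
Proof. by exists [::]; rewrite ?big_nil. Qed.

Lemma ideal_mulD I J x y :
  ideal_mul I J x -> ideal_mul I J y -> ideal_mul I J (x + y).
Proof.
move=> [s Hs ->] [t Ht ->]; exists (s ++ t); last by rewrite big_cat.
by move=> z; rewrite mem_cat => /orP[/Hs|/Ht].
Qed.

Lemma ideal_mul_in I J x y : I x -> J y -> ideal_mul I J (x * y).
Proof.
move=> Ix Jy; exists [:: x * y]; last by rewrite big_seq1.
by move=> z; rewrite inE => /eqP ->; exists x => //; exists y.
Qed.

Lemma ideal_mul_sub I J S : S 0 -> (forall x y, S x -> S y -> S (x + y)) ->
  (forall x y, I x -> J y -> S (x * y)) -> ideal_mul I J `<=` S.
Proof.
move=> S0 SD SM x [s Hs ->]; rewrite big_seq.
by elim/big_ind: _ => // y /Hs[a Ia [b Jb <-]]; apply: SM.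
Qed.

Lemma ideal_mulC I J : ideal_mul I J = ideal_mul J I.
Proof.
by apply/seteqP; split; apply: ideal_mul_sub; do ?[exact: ideal_mul0
  | exact: ideal_mulD] => x y Ix Jy; rewrite mulrC; apply: ideal_mul_in.
Qed.

Lemma ideal_mulA I J P : ideal_mul I (ideal_mul J P) = ideal_mul (ideal_mul I J) P.
Proof.
apply/seteqP; split; apply: ideal_mul_sub; do ?[exact: ideal_mul0
  | exact: ideal_mulD] => x y Hx Hy.
  apply: (ideal_mul_sub (S := fun z => ideal_mul (ideal_mul I J) P (x * z))) Hy.
  - by rewrite mulr0; apply: ideal_mul0.
  - by move=> u v; rewrite mulrDr; apply: ideal_mulD.
  - by move=> u v Ju Pv; rewrite mulrA; do !apply: ideal_mul_in.
apply: (ideal_mul_sub (S := fun z => ideal_mul I (ideal_mul J P) (z * y))) Hx.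
- by rewrite mul0r; apply: ideal_mul0.
- by move=> u v; rewrite mulrDl; apply: ideal_mulD.
- by move=> u v Ju Pv; rewrite -mulrA; do !apply: ideal_mul_in.
Qed.

Lemma ideal_mulACA I J P Q : ideal_mul (ideal_mul I J) (ideal_mul P Q) =
  ideal_mul (ideal_mul I P) (ideal_mul J Q).
Proof.
by rewrite -!ideal_mulA; congr ideal_mul; rewrite !ideal_mulA (ideal_mulC J).
Qed.

Lemma ideal_scale_mull a I J :
  ideal_mul (ideal_scale a I) J = ideal_scale a (ideal_mul I J).
Proof.
apply/seteqP; split.
  apply: ideal_mul_sub.
  - by exists 0; [apply: ideal_mul0 | rewrite mulr0].
  - move=> _ _ [x Hx <-] [y Hy <-]; exists (x + y); last by rewrite mulrDr.
    exact: ideal_mulD.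
  - move=> _ y [x Ix <-] Jy; exists (x * y); last by rewrite mulrA.
    exact: ideal_mul_in.
move=> _ [x Hx <-].
apply: (ideal_mul_sub (S := fun z => ideal_mul (ideal_scale a I) J (a * z))) Hx.
- by rewrite mulr0; apply: ideal_mul0.
- by move=> u v; rewrite mulrDr; apply: ideal_mulD.
- by move=> u v Iu Jv; rewrite mulrA; apply: ideal_mul_in => //; exists u.
Qed.

Lemma ideal_scale_mulr a I J :
  ideal_mul I (ideal_scale a J) = ideal_scale a (ideal_mul I J).
Proof. by rewrite ideal_mulC ideal_scale_mull ideal_mulC. Qed.

Lemma ideal_scaleA a b I :
  ideal_scale a (ideal_scale b I) = ideal_scale (a * b) I.
Proof.
apply/seteqP; split=> [_ [_ [x Ix <-] <-]|_ [x Ix <-]].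
  by exists x; rewrite ?mulrA.
by exists (b * x); rewrite ?mulrA //; exists x.
Qed.

Lemma ideal_scale1 I : ideal_scale 1 I = I.
Proof.
apply/seteqP; split=> [_ [x Ix <-]|x Ix]; first by rewrite mul1r.
by exists x; rewrite ?mul1r.
Qed.

Lemma ideal_mul_roi K I : submodule K I -> ideal_mul I (ring_of_integers K) = I.
Proof.
move=> [I0 ID IM]; apply/seteqP; split.
  by apply: ideal_mul_sub => // x y Ix Oy; rewrite mulrC; apply: IM.
by move=> x Ix; rewrite -[x]mulr1; apply: ideal_mul_in => //; apply: roi1.
Qed.

Lemma submodule_roi K : submodule K (ring_of_integers K).
Proof. by split; [apply: roi0 | apply: roiD | apply: roiM]. Qed.

Lemma submodule_mulr K I J : submodule K J -> submodule K (ideal_mul I J).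
Proof.
move=> [J0 JD JM]; split; [exact: ideal_mul0 | exact: ideal_mulD |].
move=> a x Oa.
apply: (ideal_mul_sub (S := fun z => ideal_mul I J (a * z))).
- by rewrite mulr0; apply: ideal_mul0.
- by move=> u v; rewrite mulrDr; apply: ideal_mulD.
- by move=> u v Iu Jv; rewrite mulrCA; apply: ideal_mul_in => //; apply: JM.
Qed.

Lemma fractional_roi K : fractional_ideal K (ring_of_integers K).
Proof.
split; [exact: submodule_roi | by move=> x [] |].
exists 1; rewrite oner_eq0 ideal_scale1; split=> //; exact: roi1.
Qed.

Lemma fractional_mul K I J : fractional_ideal K I -> fractional_ideal K J ->
  fractional_ideal K (ideal_mul I J).
Proof.
move=> [_ KI [d [Od d0 dI]]] [sJ KJ [e [Oe e0 eJ]]].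
split; first exact: submodule_mulr.
- apply: ideal_mul_sub; [exact: mem0v | by move=> *; apply: memvD |].
  by move=> x y /KI Kx /KJ Ky; apply: rpredM.
- exists (d * e); split; [exact: roiM | by rewrite mulf_neq0 |].
  rewrite -ideal_scaleA -ideal_scale_mulr -ideal_scale_mull.
  apply: ideal_mul_sub; [exact: roi0 | exact: roiD |].
  by move=> x y /dI Ox /eJ Oy; apply: roiM.
Qed.

Lemma invertible_roi K : invertible_ideal K (ring_of_integers K).
Proof.
split; first exact: fractional_roi.
exists (ring_of_integers K); first exact: fractional_roi.
exact/ideal_mul_roi/submodule_roi.
Qed.

Lemma invertible_mul K I J : invertible_ideal K I -> invertible_ideal K J ->
  invertible_ideal K (ideal_mul I J).
Proof.
move=> [fI [I' fI' II']] [fJ [J' fJ' JJ']]; split; first exact: fractional_mul.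
exists (ideal_mul I' J'); first exact: fractional_mul.
by rewrite ideal_mulACA II' JJ'; apply/ideal_mul_roi/submodule_roi.
Qed.

Lemma ideal_invE K I J : fractional_ideal K I -> fractional_ideal K J ->
  ideal_mul I J = ring_of_integers K -> ideal_inv K I = J.
Proof.
move=> [_ KI _] [sJ KJ _] IJ; apply/seteqP; split=> x.
  move=> [Kx xI]; rewrite -(ideal_mul_roi sJ) ideal_mulC.
  have : ideal_scale x (ideal_mul I J) x.
    by rewrite IJ; exists 1; [apply: roi1 | rewrite mulr1].
  rewrite -ideal_scale_mull; apply: ideal_mul_sub.
  - exact: ideal_mul0.
  - exact: ideal_mulD.
  - by move=> u v /xI Ou Jv; apply: ideal_mul_in.
move=> Jx; split; first exact: KJ.
by move=> _ [y Iy <-]; rewrite -IJ mulrC; apply: ideal_mul_in.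
Qed.

Lemma invertible_inv K I : invertible_ideal K I ->
  invertible_ideal K (ideal_inv K I) /\
  ideal_mul (ideal_inv K I) I = ring_of_integers K.
Proof.
move=> [fI [J fJ IJ]]; rewrite (ideal_invE fI fJ IJ) ideal_mulC.
by split=> //; split=> //; exists I; rewrite // ideal_mulC.
Qed.

Lemma ideal_inv_scale K a I : a \in K -> a != 0 ->
  ideal_inv K (ideal_scale a I) = ideal_scale a^-1 (ideal_inv K I).
Proof.
move=> Ka a0; apply/seteqP; split=> [x [Kx xI]|_ [x [Kx xI] <-]].
  exists (a * x); last by rewrite mulKf.
  by split; [apply: rpredM | rewrite mulrC -ideal_scaleA].
split; first by rewrite rpredM ?rpredV.
by rewrite ideal_scaleA mulrAC mulVf ?mul1r.
Qed.

Lemma ideal_class_refl K I : ideal_class K I I.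
Proof.
by exists 1; [split; [apply: mem1v | apply: oner_neq0] | rewrite ideal_scale1].
Qed.

End Ideals.

(* The operations on classes are the setwise operations on cosets. *)
Record class_group (N : fieldExtType rat) (K : {subfield N}) := ClassGroup {
  class_set :> set (set N);
  class_setP : exists2 I, invertible_ideal K I & class_set = ideal_class K I
}.

Section ClassGroup.
Variables (N : fieldExtType rat) (K : {subfield N}).
Implicit Types (c d e : class_group K) (I J : set N).

HB.instance Definition _ := gen_eqMixin (class_group K).
HB.instance Definition _ := gen_choiceMixin (class_group K).

Lemma class_inj c d : class_set c = class_set d -> c = d.
Proof. by case: c d => [c cP] [d dP] /= E; case: _ / E dP => dP; congr ClassGroup. Qed.

Definition class_of I (hI : invertible_ideal K I) : class_group K :=
  ClassGroup (ex_intro2 _ _ I hI erefl).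

Lemma class_addE I J :
  [set ideal_mul A B | A in ideal_class K I & B in ideal_class K J]
  = ideal_class K (ideal_mul I J).
Proof.
apply/seteqP; split.
  move=> _ [_ [a [Ka a0] <-] [_ [b [Kb b0] <-] <-]]; exists (a * b).
    by split; [apply: rpredM | rewrite mulf_neq0].
  by rewrite ideal_scale_mull ideal_scale_mulr ideal_scaleA.
move=> _ [a Ha <-]; exists (ideal_scale a I); first by exists a.
exists J; first exact: ideal_class_refl.
by rewrite ideal_scale_mull.
Qed.

Lemma class_oppE I :
  [set ideal_inv K A | A in ideal_class K I] = ideal_class K (ideal_inv K I).
Proof.
apply/seteqP; split.
  move=> _ [_ [a [Ka a0] <-] <-]; exists a^-1; last by rewrite ideal_inv_scale.
  by split; rewrite ?rpredV ?invr_eq0.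
move=> _ [a [Ka a0] <-]; exists (ideal_scale a^-1 I).
  by exists a^-1 => //; split; rewrite ?rpredV ?invr_eq0.
by rewrite ideal_inv_scale ?rpredV ?invr_eq0 // invrK.
Qed.

Lemma class_add_subproof c d :
  exists2 I, invertible_ideal K I
    & [set ideal_mul A B | A in class_set c & B in class_set d] = ideal_class K I.
Proof.
have [I hI ->] := class_setP c; have [J hJ ->] := class_setP d.
by exists (ideal_mul I J); [apply: invertible_mul | apply: class_addE].
Qed.

Lemma class_opp_subproof c :
  exists2 I, invertible_ideal K I
    & [set ideal_inv K A | A in class_set c] = ideal_class K I.
Proof.
have [I hI ->] := class_setP c; exists (ideal_inv K I); last exact: class_oppE.
by have [] := invertible_inv hI.
Qed.

Definition class_zero : class_group K := class_of (invertible_roi K).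
Definition class_add c d : class_group K := ClassGroup (class_add_subproof c d).
Definition class_opp c : class_group K := ClassGroup (class_opp_subproof c).

Lemma class_addA : associative class_add.
Proof.
move=> c d e; apply: class_inj => /=.
have [I hI ->] := class_setP c; have [J hJ ->] := class_setP d.
by have [M hM ->] := class_setP e; rewrite !class_addE ideal_mulA.
Qed.

Lemma class_addC : commutative class_add.
Proof.
move=> c d; apply: class_inj => /=.
have [I hI ->] := class_setP c; have [J hJ ->] := class_setP d.
by rewrite !class_addE ideal_mulC.
Qed.

Lemma class_add0 : left_id class_zero class_add.
Proof.
move=> c; apply: class_inj => /=; have [I [[sI _ _] _] ->] := class_setP c.
by rewrite class_addE ideal_mulC ideal_mul_roi.
Qed.

Lemma class_addN : left_inverse class_zero class_opp class_add.
Proof.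
move=> c; apply: class_inj => /=; have [I hI ->] := class_setP c.
by rewrite class_oppE class_addE; have [_ ->] := invertible_inv hI.
Qed.

HB.instance Definition _ :=
  GRing.isZmodule.Build (class_group K) class_addA class_addC class_add0 class_addN.

End ClassGroup.

Definition subgroup (V : zmodType) : set (set V) :=
  [set S | S 0 /\ forall x y, S x -> S y -> S (x - y)].

Definition generated_subgroup (V : zmodType) (G : set V) : set V :=
  smallest (@subgroup V) G.

Definition subgroup_isomorphic (U V : zmodType) (A : set U) (B : set V) :=
  exists f : U -> V,
    set_bij A B f /\ forall x y, A x -> A y -> f (x + y) = f x + f y.

Definition internal_direct_sum (V : zmodType) (S A B : set V) :=
  [/\ subgroup A, subgroup B, S = [set a + b | a in A & b in B]
    & A `&` B = [set 0]].

Definition polya_group (N : fieldExtType rat) (K : {subfield N}) :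
    set (class_group K) :=
  generated_subgroup
    [set c | exists2 q : nat, (0 < q)%N & class_set c (Pi_ideal K q)].
Arguments polya_group {N} K.

Section Extension.
Variables (N : fieldExtType rat) (K L : {subfield N}).
Context (KL : (K <= L)%VS).

Definition ideal_extend (I : set N) : set N := ideal_mul I (ring_of_integers L).

Lemma roi_sub : ring_of_integers K `<=` ring_of_integers L.
Proof. by move=> x [Kx ix]; split=> //; apply: (subvP KL). Qed.

Lemma ideal_extendM I J :
  ideal_extend (ideal_mul I J) = ideal_mul (ideal_extend I) (ideal_extend J).
Proof.
by rewrite /ideal_extend ideal_mulACA (ideal_mul_roi (submodule_roi L)).
Qed.

Lemma ideal_extend_roi : ideal_extend (ring_of_integers K) = ring_of_integers L.
Proof.
apply/seteqP; split.
  apply: ideal_mul_sub; [exact: roi0 | exact: roiD |].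
  by move=> x y /roi_sub; apply: roiM.
by move=> x Ox; rewrite -[x]mul1r; apply: ideal_mul_in => //; apply: roi1.
Qed.

Lemma fractional_extend I :
  fractional_ideal K I -> fractional_ideal L (ideal_extend I).
Proof.
move=> [sI KI [d [Od d0 dI]]]; split.
- exact/submodule_mulr/submodule_roi.
- apply: ideal_mul_sub; [exact: mem0v | by move=> *; apply: memvD |].
  by move=> x y /KI Kx [Ly _]; apply: rpredM => //; apply: (subvP KL).
- exists d; split=> //; first exact: roi_sub.
  rewrite -ideal_scale_mull; apply: ideal_mul_sub; [exact: roi0 | exact: roiD |].
  by move=> x y /dI /roi_sub; apply: roiM.
Qed.

Lemma invertible_extend I :
  invertible_ideal K I -> invertible_ideal L (ideal_extend I).
Proof.
move=> [fI [J fJ IJ]]; split; first exact: fractional_extend.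
exists (ideal_extend J); first exact: fractional_extend.
by rewrite -ideal_extendM IJ ideal_extend_roi.
Qed.

Lemma class_extend_subproof (c : class_group K) :
  exists2 I, invertible_ideal L I
    & \bigcup_(A in class_set c) ideal_class L (ideal_extend A) = ideal_class L I.
Proof.
have [I hI ->] := class_setP c; exists (ideal_extend I).
  exact: invertible_extend.
apply/seteqP; split; last first.
  by move=> A HA; exists I => //; apply: ideal_class_refl.
move=> _ [_ [a [Ka a0] <-] [b [Lb b0] <-]]; exists (b * a).
  by split; [rewrite rpredM // (subvP KL) | rewrite mulf_neq0].
by rewrite /ideal_extend ideal_scale_mull ideal_scaleA.
Qed.

Definition class_extend (c : class_group K) : class_group L :=
  ClassGroup (class_extend_subproof c).

Lemma class_extend_of (I : set N) (hI : invertible_ideal K I) :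
  class_extend (class_of hI) = class_of (invertible_extend hI).
Proof.
apply: class_inj; apply/seteqP; split => /=.
  move=> _ [_ [a [Ka a0] <-] [b [Lb b0] <-]]; exists (b * a).
    by split; [rewrite rpredM // (subvP KL) | rewrite mulf_neq0].
  by rewrite /ideal_extend ideal_scale_mull ideal_scaleA.
by move=> A HA; exists I => //; apply: ideal_class_refl.
Qed.

Lemma class_extendD (c d : class_group K) :
  class_extend (c + d) = class_extend c + class_extend d.
Proof.
have class_ofE (M : {subfield N}) (e : class_group M) :
    exists I, exists hI : invertible_ideal M I, e = class_of hI.
  have [I hI eI] := class_setP e.
  by exists I, hI; apply: class_inj.
have class_ofD (M : {subfield N}) I J (hI : invertible_ideal M I)
    (hJ : invertible_ideal M J) :
    class_of hI + class_of hJ = class_of (invertible_mul hI hJ).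
  by apply: class_inj; apply: class_addE.
have [I [hI ->]] := class_ofE _ c; have [J [hJ ->]] := class_ofE _ d.
rewrite class_ofD !class_extend_of class_ofD.
by apply: class_inj; rewrite /= ideal_extendM.
Qed.

End Extension.

(* Main.v *)
Require Import Defs.
From HB Require Import structures.
From mathcomp Require Import all_boot all_order all_algebra all_field.
From mathcomp Require Import all_fingroup.
From mathcomp Require Import finmap all_classical.
From mathcomp Require Import ring.

(** Write R_p(K) for the product of the maximal ideals of K above a prime p.
    When K is Galois over Q these ideals are conjugate, so they have the same
    norm, which is a power of p: the Pi_q(K) other than the unit ideal are the
    R_p(K), and Po(K) is generated by their classes ([polya_group_sub]).

    Let K <= L be Galois over Q.  A proper ideal of L that is stable under all
    the automorphisms and contains a power of p lies in one prime above p, hence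
    in all of them, hence in R_p(L); dividing by R_p(L) and iterating, it is a
    power of R_p(L) ([invariant_power]).  In particular R_p(K) O_L = R_p(L)^e,
    and e divides [L:K] ([ramification]): the norms of the elements of R_p(L)
    generate an invariant ideal of K, so a power R_p(K)^j, and its extension
    R_p(L)^(e j) is R_p(L)^[L:K], because some element of R_p(L) has valuation
    exactly 1 at all the conjugates of a given prime.

    Put n1 = [K1:K0] and n2 = [K2:K0].  Then [L:K1] divides n2 and [L:K2]
    divides n1 ([dim_compositum_dvdn]), and three facts give the theorem.
    - The multiples of the class of R_p(L) by some e1 | n2 and e2 | n1 are in
      the images of Po(K1) and Po(K2); since e1 and e2 are coprime, these
      images span Po(L).
    - R_p(Ki) has a power of exponent dividing ni which is the extension of
      R_p(K0), a principal ideal, so ni kills Po(Ki) ([polya_group_killed]);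
      since n1 and n2 are coprime, the two images meet in 0.
    - If I O_L = a O_L then I^[L:K1] is generated by the norm of a, so [L:K1]
      kills the kernel of Cl(K1) -> Cl(L) ([class_extend_kernel]), and this
      kernel meets Po(K1), which n1 kills, in 0.

    The only fact about Dedekind domains behind these arguments is that the
    maximal ideals are invertible ([maximal_invertible]).  Let P be a maximal
    ideal above p.  An element x of K is a root of an integer polynomial q with
    a coefficient prime to p; if q = (X - x) g, the g_j and the x g_j are
    integral, and they are not all in P because q_j = g_(j-1) - x g_j.  So x or
    1/x is a fraction with a denominator outside P ([maximal_compare]): the
    local ring at P is a valuation ring.  Moreover O_K / p O_K has dimension at
    most dim N over F_p ([primitive_relation]), so P is finitely generated,
    hence locally principal at P, hence invertible. *)

Set Implicit Arguments.
Unset Strict Implicit.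
Unset Printing Implicit Defensive.

Import GRing.Theory Num.Theory.

Local Open Scope classical_set_scope.
Local Open Scope ring_scope.

(** * Subgroups of abelian groups *)

Section AbelianGroups.
Implicit Types U V W : zmodType.

Lemma subgroup0 V (S : set V) : subgroup S -> S 0. Proof. by case. Qed.

Lemma subgroupB V (S : set V) x y : subgroup S -> S x -> S y -> S (x - y).
Proof. by case=> _; apply. Qed.

Lemma subgroupN V (S : set V) x : subgroup S -> S x -> S (- x).
Proof. by move=> gS Sx; rewrite -sub0r; apply: subgroupB => //; apply: subgroup0. Qed.

Lemma subgroupD V (S : set V) x y : subgroup S -> S x -> S y -> S (x + y).
Proof. by move=> gS Sx Sy; rewrite -[y]opprK; apply: subgroupB => //; apply: subgroupN. Qed.

Lemma subgroup_sum V (S : set V) (I : Type) (r : seq I) (Q : pred I) (F : I -> V) :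
  subgroup S -> (forall i, Q i -> S (F i)) -> S (\sum_(i <- r | Q i) F i).
Proof.
move=> gS SF; elim/big_ind: _ => //; first exact: subgroup0.
by move=> x y; apply: subgroupD.
Qed.

Lemma subgroup_mulrz V (S : set V) x (z : int) : subgroup S -> S x -> S (x *~ z).
Proof.
move=> gS Sx; have Sn n : S (x *+ n).
  by elim: n => [|n IHn]; [apply: subgroup0 | rewrite mulrS; apply: subgroupD].
by case: z => n; [exact: Sn | rewrite NegzE mulrNz; apply: subgroupN; rewrite // -pmulrn].
Qed.

Lemma subgroup_coprime V (S : set V) x m n :
  subgroup S -> coprime m n -> S (x *+ m) -> S (x *+ n) -> S x.
Proof.
move=> gS mn Sm Sn.
have /coprimezP[[u v] /= uv] : coprimez m n by rewrite /coprimez /gcdz /= eqz_nat.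
rewrite -[x]mulr1z -uv mulrzDr ![_ * Posz _]mulrC !mulrzA -!pmulrn.
by apply: subgroupD => //; apply: subgroup_mulrz.
Qed.

Lemma coprime_torsion V (x : V) m n : coprime m n -> x *+ m = 0 -> x *+ n = 0 -> x = 0.
Proof.
apply: (subgroup_coprime (S := [set 0])).
by split=> // y z -> ->; rewrite subrr.
Qed.

Lemma subgroup_add V (S T : set V) :
  subgroup S -> subgroup T -> subgroup [set x + y | x in S & y in T].
Proof.
move=> gS gT; split.
  by exists 0; [apply: subgroup0 | exists 0; [apply: subgroup0 | rewrite addr0]].
move=> _ _ [x Sx [y Ty <-]] [x' Sx' [y' Ty' <-]].
exists (x - x'); first exact: subgroupB.
by exists (y - y'); [apply: subgroupB | rewrite opprD addrACA].
Qed.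

Lemma mulrn_subgroup V n : subgroup [set x : V | x *+ n = 0].
Proof. by split=> [|x y /= x0 y0]; rewrite /= ?mul0rn // mulrnBl x0 y0 subr0. Qed.

Lemma generated_subgroup_subgroup V (G : set V) : subgroup (generated_subgroup G).
Proof.
split=> [S [gS _]|x y Sx Sy S [gS GS]]; first by case: gS.
by have [_] := gS; apply; [apply: Sx | apply: Sy].
Qed.

Lemma generated_subgroup_sub V (G S : set V) :
  subgroup S -> G `<=` S -> generated_subgroup G `<=` S.
Proof. by move=> gS GS x; apply. Qed.

Section AdditiveMap.
Variables (U W : zmodType) (f : U -> W).
Hypothesis fD : forall x y, f (x + y) = f x + f y.

Lemma additive_map0 : f 0 = 0.
Proof. by apply: (addrI (f 0)); rewrite -fD !addr0. Qed.

Lemma additive_mapB x y : f (x - y) = f x - f y.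
Proof. by apply: (addIr (f y)); rewrite -fD !subrK. Qed.

Lemma additive_mapMn x n : f (x *+ n) = f x *+ n.
Proof. by elim: n => [|n IHn]; rewrite ?additive_map0 // !mulrS fD IHn. Qed.

Lemma image_subgroup (A : set U) : subgroup A -> subgroup (f @` A).
Proof.
move=> [A0 AB]; split; first by exists 0; rewrite ?additive_map0.
move=> _ _ [x Ax <-] [y Ay <-]; exists (x - y); first exact: AB.
exact: additive_mapB.
Qed.

Lemma preimage_subgroup (S : set W) : subgroup S -> subgroup (f @^-1` S).
Proof.
move=> gS; split=> [|x y Sx Sy] /=; first by rewrite additive_map0; apply: subgroup0.
by rewrite additive_mapB; apply: subgroupB.
Qed.

End AdditiveMap.

(** The images of A and B are killed by the coprime numbers m and n, so they
    meet in 0; and an element of A killed by f is killed by both m and n. *)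
Lemma coprime_direct_sum U V W (f : U -> W) (g : V -> W)
    (A : set U) (B : set V) m n :
    (forall x y, f (x + y) = f x + f y) -> (forall x y, g (x + y) = g x + g y) ->
    subgroup A -> subgroup B -> coprime m n ->
    (forall x, A x -> x *+ m = 0) -> (forall y, B y -> y *+ n = 0) ->
    (forall x, f x = 0 -> x *+ n = 0) -> (forall y, g y = 0 -> y *+ m = 0) ->
  let S := [set x + y | x in f @` A & y in g @` B] in
  subgroup_isomorphic S (A `*` B) /\ internal_direct_sum S (f @` A) (g @` B).
Proof.
move=> fD gD gA gB mn Am Bn kf kg S.
have disj x y : A x -> B y -> f x = g y -> x = 0 /\ y = 0.
  move=> Ax By fxgy; have fx0 : f x = 0.
    apply: (coprime_torsion mn); first by rewrite -additive_mapMn // Am // additive_map0.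
    by rewrite fxgy -additive_mapMn // Bn // additive_map0.
  split; first by apply: (coprime_torsion mn); [apply: Am | apply: kf].
  by apply: (coprime_torsion mn); [apply: kg; rewrite -fxgy | apply: Bn].
split; last first.
  split=> //; try exact: image_subgroup.
  apply/seteqP; split=> [_ [[x Ax <-] [y By gyfx]]|_ ->]; last first.
    by split; exists 0; rewrite ?additive_map0 //; apply: subgroup0.
  by have [-> _] := disj x y Ax By (esym gyfx); rewrite /= additive_map0.
(* The isomorphism sends w to the unique pair that represents it. *)
pose rep w : set (U * V) := [set z | [/\ A z.1, B z.2 & w = f z.1 + g z.2]].
have S_rep w z : rep w z -> S w.
  by move=> [Az Bz ->]; exists (f z.1); [exists z.1 | exists (g z.2); [exists z.2|]].
have rep_inj w z z' : rep w z -> rep w z' -> z = z'.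
  move=> [Az Bz wz] [Az' Bz' wz'].
  have [|||] := disj (z.1 - z'.1) (z'.2 - z.2); [exact: subgroupB | exact: subgroupB | |].
    rewrite !additive_mapB //; apply/eqP.
    by rewrite subr_eq addrAC [g z'.2 + _]addrC -wz' wz addrK.
  move=> /eqP; rewrite subr_eq0 => /eqP E1 /eqP; rewrite subr_eq0 => /eqP E2.
  by rewrite [z]surjective_pairing [z']surjective_pairing E1 E2.
pose h w : U * V := xget (0, 0) (rep w).
have hP w : S w -> rep w (h w).
  by move=> [_ [x Ax <-] [_ [y By <-] <-]]; apply: (@xgetPex _ (0, 0)); exists (x, y).
exists h; split; first split.
- by move=> w /hP[].
- move=> w w' /set_mem/hP[_ _ wE] /set_mem/hP[_ _ w'E] hE.
  by rewrite wE w'E hE.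
- move=> z [Az Bz]; have zE : rep (f z.1 + g z.2) z by [].
  by exists (f z.1 + g z.2); [apply: S_rep zE | apply: rep_inj (hP _ (S_rep _ _ zE)) zE].
move=> w w' Sw Sw'; have [Ah Bh wE] := hP _ Sw; have [Ah' Bh' wE'] := hP _ Sw'.
have rww' : rep (w + w') (h w + h w').
  split=> /=; [exact: subgroupD | exact: subgroupD |].
  by rewrite fD gD addrACA -wE -wE'.
exact: rep_inj (hP _ (S_rep _ _ rww')) rww'.
Qed.

End AbelianGroups.

(** * Integers of number fields and relations modulo p *)

Section Integers.
Variable N : fieldExtType rat.
Implicit Types (K : {subfield N}) (x y : N).

Lemma alg_int (z : int) : (z%:~R : rat)%:A = z%:~R :> N.
Proof. exact: (rmorph_int (in_alg N)). Qed.

Lemma rational_integral x :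
  x \in 1%VS -> integralOver (intr : int -> N) x -> exists z : int, x = z%:~R.
Proof.
move=> /vlineP[r ->] [q qmon qr].
have qQ : root (map_poly (intr : int -> rat) q) r.
  rewrite -(fmorph_root (in_alg N)) -map_poly_comp.
  by rewrite (eq_map_poly (g := (intr : int -> N))) // => z /=; rewrite alg_int.
have qC : root (map_poly (intr : int -> algC) q) (ratr r).
  move: qQ; rewrite -(fmorph_root (@ratr algC)) -map_poly_comp.
  by rewrite (eq_map_poly (g := (intr : int -> algC))) // => z /=; rewrite rmorph_int.
have : ratr r \in Aint.
  apply: (root_monic_Aint qC); first exact: monic_map.
  by apply/polyOverP => i; rewrite coef_map /= intr_int.
move=> /(Cint_rat_Aint (Crat_rat r)) /intrP[z rz].
exists z; have -> : r = z%:~R by apply: (fmorph_inj (@ratr algC)); rewrite rmorph_int.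
exact: alg_int.
Qed.

Lemma roi_int K (z : int) : ring_of_integers K z%:~R.
Proof. by split; [rewrite -[z%:~R]mulr1 mulrzl rpredMz ?mem1v | apply: integral_id]. Qed.

Lemma roi_nat K n : ring_of_integers K n%:R.
Proof. exact: (roi_int K n). Qed.

Lemma roi_opp K x : ring_of_integers K x -> ring_of_integers K (- x).
Proof. by rewrite -mulN1r; apply: roiM; exact: (roi_int K (-1)). Qed.

Lemma roiB K x y :
  ring_of_integers K x -> ring_of_integers K y -> ring_of_integers K (x - y).
Proof. by move=> Kx Ky; apply: roiD => //; apply: roi_opp. Qed.

Lemma roi_sum K (I : Type) (r : seq I) (Q : pred I) (F : I -> N) :
  (forall i, Q i -> ring_of_integers K (F i)) ->
  ring_of_integers K (\sum_(i <- r | Q i) F i).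
Proof. by move=> KF; elim/big_ind: _ => //; [apply: roi0 | apply: roiD]. Qed.

Lemma roi_prod K (I : Type) (r : seq I) (Q : pred I) (F : I -> N) :
  (forall i, Q i -> ring_of_integers K (F i)) ->
  ring_of_integers K (\prod_(i <- r | Q i) F i).
Proof. by move=> KF; elim/big_ind: _ => //; [apply: roi1 | apply: roiM]. Qed.

Lemma intrN_inj : injective (intr : int -> N).
Proof.
move=> a b ab; apply: (@intr_inj rat); apply: (fmorph_inj (in_alg N)).
by rewrite /= !alg_int.
Qed.

Lemma natrN_neq0 n : (0 < n)%N -> n%:R != 0 :> N.
Proof.
by case: n => // n _; apply/eqP => /(@intrN_inj (n.+1) 0).
Qed.

(** This bounds by dim N the rank modulo p of every group of elements of N; it
    plays the part of an integral basis of O_K. *)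
Lemma primitive_relation p m (y : 'I_m -> N) :
  prime p -> (\dim {:N} < m)%N ->
  exists2 c : 'I_m -> int, \sum_i (c i)%:~R * y i = 0
    & exists i, ~~ (p %| c i)%Z.
Proof.
move=> pp ltnm.
have [q q0 [i0 qi0]] : exists2 q : 'I_m -> rat, \sum_i q i *: y i = 0
    & exists i, q i != 0.
  have : ~~ free [tuple y i | i < m].
    apply/negP => /eqP Hf; move: (dimvS (subvf <<[tuple y i | i < m]>>%VS)).
    by rewrite Hf size_tuple leqNgt ltnm.
  move=> /freeP Hn; apply: contrapT => Hex; apply: Hn => q q0 i.
  apply/eqP/negPn/negP => qi; apply: Hex; exists q; last by exists i.
  by rewrite -[RHS]q0; apply: eq_bigr => j _; rewrite -tnth_nth tnth_mktuple.
(* Clear the denominators. *)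
pose D := \prod_i denq (q i).
have D0 : D != 0 by apply/prodf_neq0 => i _; apply: denq_neq0.
pose c i := numq (q i) * \prod_(j | j != i) denq (q j).
have cE i : (c i)%:~R = D%:~R * q i.
  rewrite /D (bigD1 i) //= !intrM -[X in _ = _ * X]divq_num_den.
  by rewrite mulrAC mulrCA divff ?mulr1 // intr_eq0 denq_neq0.
have c0 : \sum_i (c i)%:~R * y i = 0.
  have E i : (c i)%:~R * y i = D%:~R * (q i *: y i).
    by rewrite -!alg_int cE -!scalerAl !mul1r scalerA.
  by rewrite (eq_bigr _ (fun i _ => E i)) -mulr_sumr q0 mulr0.
have ci0 : c i0 != 0 by rewrite -(intr_eq0 rat) cE mulf_neq0 ?intr_eq0.
(* Divide the relation by p until some coefficient is prime to p. *)
move: {q q0 qi0 D D0 cE} c c0 ci0 => c.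
have [n] := ubnP `|c i0|%N; elim: n c => // n IHn c lecn c0 ci0.
have [[i ci]|Hall] := pselect (exists i, ~~ (p %| c i)%Z).
  by exists c => //; exists i.
have pc i : (p %| c i)%Z by apply/negPn/negP => ci; apply: Hall; exists i.
have cE i : c i = (c i %/ p)%Z * p by rewrite divzK.
apply: (IHn (fun i => c i %/ p)%Z).
- have := cE i0; set a := (c i0 %/ p)%Z => ca.
  rewrite ltnS ca abszM absz_nat in lecn; apply: leq_trans lecn.
  rewrite ltn_Pmulr ?prime_gt1 // absz_gt0.
  by apply: contraNneq ci0 => a0; rewrite ca a0 mul0r.
- apply: (mulIf (natrN_neq0 (prime_gt0 pp))); rewrite mul0r mulr_suml -[RHS]c0.
  by apply: eq_bigr => i _; rewrite mulrAC -[p%:R]/(p%:~R) -intrM -cE.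
- by apply: contraNneq ci0 => E; rewrite (cE i0) E mul0r.
Qed.

Lemma subgroup_int (S : set N) (z : int) x : subgroup S -> S x -> S (z%:~R * x).
Proof. by rewrite mulrzl; apply: subgroup_mulrz. Qed.

Lemma bezout_prime p (z : int) : prime p -> ~~ (p %| z)%Z ->
  exists u v : int, u%:~R * z%:~R + v%:~R * p%:R = 1 :> N.
Proof.
move=> pp npz.
have /coprimezP[[u v] /= uv] : coprimez z p.
  by rewrite coprimez_sym /coprimez /gcdz /= eqz_nat -/(coprime _ _) prime_coprime.
by exists u, v; rewrite -[p%:R]/(p%:~R) -!intrM -intrD uv.
Qed.

Lemma subgroup_cancel_int (S : set N) p (z : int) x : prime p -> subgroup S ->
  ~~ (p %| z)%Z -> S (z%:~R * x) -> S (p%:R * x) -> S x.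
Proof.
move=> pp gS npz Sz Sp; have [u [v uv]] := bezout_prime pp npz.
by rewrite -[x]mul1r -uv mulrDl -!mulrA; apply: subgroupD => //; apply: subgroup_int.
Qed.

End Integers.

(** * Quotients of polynomials with integral coefficients *)

Section Kaplansky.
Variable N : fieldExtType rat.
Implicit Types (K : {subfield N}) (x y : N) (q g : {poly N}).
Local Notation integral := (integralOver (intr : int -> N)).

(** If c is the leading coefficient of q and n its degree, c^(n-1) q(x) is a
    monic polynomial in c x. *)
Lemma integral_lead_root q x :
  (forall i, integral q`_i) -> root q x -> integral (lead_coef q * x).
Proof.
move=> qZ /rootP qx; pose n := (size q).-1; pose c := lead_coef q.
have [->|q0] := eqVneq q 0; first by rewrite lead_coef0 mul0r; apply: integral0.
have [n0|n_gt0] := posnP n.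
  move: qx q0; rewrite [q]size1_polyC ?hornerC; last by rewrite -subn_eq0 subn1 -/n n0.
  by move=> ->; rewrite eqxx.
have sq : size q = n.+1 by rewrite /n prednK // size_poly_gt0.
pose r0 := \poly_(i < n) (c ^+ (n.-1 - i) * q`_i); pose r := 'X^n + r0.
have sr : (size r0 < size ('X^n : {poly N}))%N.
  by rewrite size_polyXn ltnS size_poly.
have rm : r \is monic by rewrite monicE lead_coefDl // lead_coefXn.
apply: (integral_root_monic rm).
  apply/rootP; rewrite hornerD hornerXn horner_poly.
  have /(congr1 (fun z => c ^+ n.-1 * z)) := qx.
  rewrite mulr0 horner_coef sq big_ord_recr /= mulrDr mulr_sumr addrC => qxc.
  rewrite -[RHS]qxc; congr (_ + _).
    have cn : c ^+ n = c ^+ n.-1 * c by rewrite -exprSr prednK.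
    by rewrite exprMn cn -mulrA.
  apply: eq_bigr => i _; rewrite exprMn.
  have lin : (i <= n.-1)%N by rewrite -ltnS prednK.
  rewrite -[in RHS](subnK lin) exprD.
  by rewrite -!mulrA; congr (_ * _); rewrite mulrCA.
apply/integral_poly => i; rewrite coefD coefXn coef_poly.
apply: integral_add; first exact: integral_nat.
case: ifP => _; last exact: integral0.
apply: integral_mul => //.
elim: (_ - _)%N => [|k IHk]; first exact: integral1.
by rewrite exprS; apply: integral_mul => //; apply: qZ.
Qed.

(** The leading coefficient c of g is also that of g (X - x), so c and c x are
    integral; hence the leading term of g can be removed. *)
Lemma integral_quotient g x :
  (forall i, integral (g * ('X - x%:P))`_i) -> forall i, integral g`_i.
Proof.
have [n] := ubnP (size g); elim: n g => // n IHn g; rewrite ltnS => len gZ.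
have [->|g0] := eqVneq g 0; first by move=> i; rewrite coef0; apply: integral0.
pose c := lead_coef g; pose m := (size g).-1.
have sg : size g = m.+1 by rewrite /m prednK // size_poly_gt0.
have cE : lead_coef (g * ('X - x%:P)) = c by rewrite lead_coefM lead_coefXsubC mulr1.
have cZ : integral c by rewrite -cE; apply: gZ.
have cxZ : integral (c * x).
  by rewrite -cE; apply: integral_lead_root; rewrite // rootM root_XsubC eqxx orbT.
have cXn_coef (a : N) k i : integral a -> integral (a *: 'X^k)`_i.
  by move=> aZ; rewrite coefZ coefXn; apply: integral_mul => //; apply: integral_nat.
have sub : (size (g - c *: 'X^m)%R < n)%N.
  apply: (leq_trans _ len); rewrite sg ltnS; apply/leq_sizeP => j.
  rewrite leq_eqVlt => /predU1P[<-|ltmj].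
    by rewrite coefB coefZ coefXn eqxx mulr1 /c /lead_coef -/m subrr.
  by rewrite coefB coefZ coefXn gtn_eqF // mulr0 subr0 nth_default ?sg.
have {}IHn := IHn _ sub.
move=> i; rewrite -[g](subrK (c *: 'X^m)) coefD; apply: integral_add.
  apply: IHn => j.
  have -> : (g - c *: 'X^m) * ('X - x%:P)
       = g * ('X - x%:P) - c *: 'X^(m.+1) + (c * x) *: 'X^m.
    by rewrite -!mul_polyC polyCM exprS; ring.
  rewrite coefD coefB; apply: integral_add; last exact: cXn_coef.
  by apply: integral_sub; [exact: gZ | exact: cXn_coef].
exact: cXn_coef.
Qed.

Lemma integral_quotient_root g x :
  (forall i, integral (g * ('X - x%:P))`_i) -> forall i, integral (x * g`_i).
Proof.
move=> gZ i; have gi := integral_quotient gZ.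
have := gZ i; rewrite mulrBr coefB coefMX coefMC mulrC => H.
(* x g_i = g_(i-1) - (g (X - x))_i, with g_(-1) = 0. *)
rewrite -[x * _](subKr (if i == 0 then 0 else g`_i.-1)).
by apply: integral_sub => //; case: ifP => // _; apply: integral0.
Qed.

End Kaplansky.

(** * Bases of subgroups modulo p *)

Section SubgroupBasis.
Variable N : fieldExtType rat.
Implicit Types (S T : set N) (x y : N).

(** The x i give a basis over F_p of the quotient of S by its intersection with
    T.  A maximal independent family exists because independence modulo T
    excludes the relations of [primitive_relation]. *)
Lemma subgroup_modp_basis p S T :
    prime p -> subgroup S -> subgroup T -> (forall x, S x -> T (p%:R * x)) ->
  exists k, exists x : 'I_k -> N,
  [/\ forall i, S (x i),
      forall c : 'I_k -> int, T (\sum_i (c i)%:~R * x i) -> forall i, (p %| c i)%Z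
    & forall y, S y -> exists c : {ffun 'I_k -> 'I_p},
        T (y - \sum_i (c i)%:R * x i)].
Proof.
move=> pp gS gT pST.
pose ind k (x : 'I_k -> N) := (forall i, S (x i)) /\
  forall c : 'I_k -> int, T (\sum_i (c i)%:~R * x i) -> forall i, (p %| c i)%Z.
pose has_ind k := `[< exists x : 'I_k -> N, ind k x >].
have ind0 : exists k, has_ind k.
  by exists 0%N; apply/asboolP; exists (fun=> 0); split=> [[]|c _ []].
have ind_bound k : has_ind k -> (k <= \dim {:N})%N.
  move=> /asboolP[x [_ xind]]; rewrite leqNgt; apply/negP => ltk.
  have [c c0 [i /negP]] := primitive_relation x pp ltk; apply.
  by apply: xind; rewrite c0; apply: subgroup0.
have [k /asboolP[x [Sx xind]] kmax] := ex_maxnP ind0 ind_bound.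
exists k, x; split=> // y Sy.
(* By maximality y, put in front of the x i, makes the family dependent. *)
pose y' (i : 'I_k.+1) := oapp x y (unlift ord0 i).
have Sy' i : S (y' i) by rewrite /y'; case: unliftP => [j|] _ /=.
have [c Tc [i /negP ci]] : exists2 c : 'I_k.+1 -> int,
    T (\sum_i (c i)%:~R * y' i) & exists i, ~~ (p %| c i)%Z.
  apply: contrapT => Hex; suff: has_ind k.+1 by move=> /kmax; rewrite ltnn.
  apply/asboolP; exists y'; split=> // c Tc i.
  by apply/negPn/negP => ci; apply: Hex; exists c => //; exists i.
move: Tc; rewrite big_ord_recl {1}/y' unlift_none /=.
under eq_bigr do rewrite /y' liftK /=.
set c0 := c ord0 => Tc.
have [pc0|npc0] := boolP (p %| c0)%Z.
  case: ci; have [j ->|->] := unliftP ord0 i; last by [].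
  apply: (xind (fun j => c (lift ord0 j))).
  rewrite -[X in T X](addKr (c0%:~R * y)); apply: subgroupD => //.
  apply: subgroupN => //; rewrite -(divzK pc0) intrM -mulrA.
  by apply: subgroup_int => //; apply: pST.
have [u [v uvN]] := bezout_prime N pp npc0.
have p0 : p != 0%N by rewrite -lt0n prime_gt0.
(* c0 is invertible modulo p, of inverse u. *)
pose d j := (- u * c (lift ord0 j) %% p)%Z.
have d0 j : 0 <= d j by rewrite modz_ge0.
have dp j : (`|d j| < p)%N by rewrite -ltz_nat gez0_abs // ltz_pmod // ltz_nat lt0n.
exists [ffun j => Ordinal (dp j)].
have -> : y - \sum_j ([ffun j => Ordinal (dp j)] j)%:R * x j =
    u%:~R * (c0%:~R * y + \sum_(j < k) (c (lift ord0 j))%:~R * x j)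
    + v%:~R * (p%:R * y)
    + \sum_j (- u * c (lift ord0 j) %/ p)%Z%:~R * (p%:R * x j).
  have dE j : ([ffun j => Ordinal (dp j)] j)%:R =
     (- u * c (lift ord0 j))%:~R - (- u * c (lift ord0 j) %/ p)%Z%:~R * p%:R :> N.
    have dZ : `|d j|%N = - u * c (lift ord0 j) - (- u * c (lift ord0 j) %/ p)%Z * p :> int.
      by rewrite gez0_abs // /d {2}(divz_eq (- u * c (lift ord0 j)) p) addrC addKr.
    by rewrite ffunE /= -[LHS]/((`|d j|%N : int)%:~R) dZ rmorphB /= [X in _ - X]intrM.
  have -> : \sum_(j < k) ([ffun j => Ordinal (dp j)] j)%:R * x j =
      - (u%:~R * \sum_(j < k) (c (lift ord0 j))%:~R * x j)
      - \sum_j (- u * c (lift ord0 j) %/ p)%Z%:~R * (p%:R * x j).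
    rewrite mulr_sumr -sumrN -sumrB; apply: eq_bigr => j _.
    by rewrite dE mulrBl mulNr rmorphN rmorphM /= !mulNr !mulrA.
  have yE : y = (u%:~R * c0%:~R + v%:~R * p%:R) * y by rewrite uvN mul1r.
  rewrite {1}yE; ring.
apply: subgroupD => //; last first.
  by apply: subgroup_sum => // j _; apply: subgroup_int => //; apply: pST.
apply: subgroupD => //; apply: subgroup_int => //; exact: pST.
Qed.

End SubgroupBasis.

(** * Maximal ideals *)

Section MaximalIdeals.
Variables (N : fieldExtType rat) (K : {subfield N}).
Implicit Types (I J P Q : set N) (x y a b : N).
Local Notation O := (ring_of_integers K).

Lemma submodule_subgroup I : submodule K I -> subgroup I.
Proof.
move=> [I0 ID IM]; split=> // x y Ix Iy; apply: ID => //.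
by rewrite -mulN1r; apply: IM => //; apply: (roi_int K (-1)).
Qed.

Lemma submodule_sum I (A : Type) (r : seq A) (Q : pred A) (F : A -> N) :
  submodule K I -> (forall i, Q i -> I (F i)) -> I (\sum_(i <- r | Q i) F i).
Proof. by move=> sI; apply: subgroup_sum; apply: submodule_subgroup. Qed.

Lemma integral_ideal_unit I : integral_ideal K I -> I 1 -> I = O.
Proof.
move=> [[_ _ IM] IO] I1; apply/seteqP; split=> // x Ox.
by rewrite -[x]mulr1; apply: IM.
Qed.

(** Zorn's lemma; the union of a chain of ideals avoiding 1 avoids 1. *)
Lemma exists_maximal_ideal I :
  integral_ideal K I -> ~ I 1 -> exists2 P, maximal_ideal K P & I `<=` P.
Proof.
move=> iI I1.
(* The empty set is there for the union of the empty chain. *)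
pose proper J := J = set0 \/ [/\ integral_ideal K J, I `<=` J & ~ J 1].
have [|P [PP Pmax]] := @Zorn_bigcup N proper.
  move=> F FP Ftot; have [[J0 FJ0 J0n0]|noJ] := pselect (exists2 J, F J & J <> set0).
    have FJ J x : F J -> J x -> [/\ integral_ideal K J, I `<=` J & ~ J 1].
      by move=> /FP[->|].
    have [iJ0 IJ0 _] : [/\ integral_ideal K J0, I `<=` J0 & ~ J0 1].
      by case: (FP _ FJ0) => // J00.
    right; split; last 2 first.
    - by move=> x Ix; exists J0 => //; apply: IJ0.
    - by move=> [J FJ' J1]; have [_ _] := FJ _ _ FJ' J1.
    - split; last by move=> x [J FJ' Jx]; have [[_ JO] _ _] := FJ _ _ FJ' Jx; apply: JO.
      split; first by exists J0 => //; case: iJ0 => -[].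
      + move=> x y [J FJ' Jx] [J' FJ'' J'y].
        have [[[_ JD _] _] _ _] := FJ _ _ FJ' Jx.
        have [[[_ JD' _] _] _ _] := FJ _ _ FJ'' J'y.
        have [JJ'|J'J] := Ftot _ _ FJ' FJ''.
          by exists J' => //; apply: JD' => //; apply: JJ'.
        by exists J => //; apply: JD => //; apply: J'J.
      + move=> a x Oa [J FJ' Jx]; exists J => //.
        by have [[[_ _ JM] _] _ _] := FJ _ _ FJ' Jx; apply: JM.
  left; apply/seteqP; split=> // x [J FJ Jx]; apply: noJ; exists J => //.
  by move=> J0; rewrite J0 in Jx.
have [iP IP P1] : [/\ integral_ideal K P, I `<=` P & ~ P 1].
  case: PP => // P0; case: (Pmax I); last by right; split.
  rewrite P0; split; first by [].
  by move=> /(_ 0); apply; case: iI => -[].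
exists P => //; split=> //; first by move=> PO; apply: P1; rewrite PO; apply: roi1.
move=> J iJ PJ; have [J1|J1] := pselect (J 1).
  by right; apply: integral_ideal_unit.
left; apply: contrapT => JP; apply: (Pmax J).
  by split=> // JP'; apply: JP; apply/seteqP.
by right; split=> //; apply: subset_trans PJ.
Qed.

Variable P : set N.
Hypothesis Pmax : maximal_ideal K P.

Lemma maximal_integral : integral_ideal K P. Proof. by case: Pmax. Qed.

Lemma maximal_submodule : submodule K P. Proof. by case: maximal_integral. Qed.

Lemma maximal_sub : P `<=` O. Proof. by case: maximal_integral. Qed.

Lemma maximal_neq1 : ~ P 1.
Proof.
by move=> P1; have [_ + _] := Pmax; apply; apply: integral_ideal_unit => //;
  apply: maximal_integral.
Qed.

Lemma maximal_comax x : O x -> ~ P x -> exists2 a, O a & P (1 - a * x).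
Proof.
move=> Ox Px; pose I := [set y | exists2 a, O a & P (y - a * x)].
have [P0 PD PM] := maximal_submodule.
have iI : integral_ideal K I.
  split; last first.
    move=> y [a Oa /maximal_sub Py]; rewrite -[y](subrK (a * x)).
    by apply: roiD => //; apply: roiM.
  split; first by exists 0; rewrite ?mul0r ?subr0 //; apply: roi0.
    move=> y z [a Oa Py] [b Ob Pz]; exists (a + b); first exact: roiD.
    have -> : y + z - (a + b) * x = (y - a * x) + (z - b * x) by ring.
    exact: PD.
  move=> b y Ob [a Oa Py]; exists (b * a); first exact: roiM.
  by rewrite -mulrA -mulrBr; apply: PM.
have [|IP|IO] := (let: And3 _ _ H := Pmax in H) _ iI.
- by move=> y Py; exists 0; rewrite ?mul0r ?subr0 //; apply: roi0.
- by case: Px; rewrite -IP; exists 1; rewrite ?mul1r ?subrr //; apply: roi1.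
- by have : I 1 by rewrite IO; apply: roi1.
Qed.

(** z is invertible modulo P, so x is congruent to a multiple of z x modulo P I,
    which A contains. *)
Lemma maximal_mul_notin I A x z :
    submodule K A -> ideal_mul P I `<=` A -> I x -> O z -> ~ P z ->
  A (z * x) -> A x.
Proof.
move=> [_ AD AM] PIA Ix Oz Pz Azx; have [a Oa Pa] := maximal_comax Oz Pz.
have -> : x = a * (z * x) + (1 - a * z) * x by ring.
by apply: AD; [apply: AM | apply/PIA/ideal_mul_in].
Qed.

Lemma maximal_prime x y : O x -> O y -> P (x * y) -> P x \/ P y.
Proof.
move=> Ox Oy Pxy; have [Px|Px] := pselect (P x); [by left | right].
apply: (maximal_mul_notin (I := O) (z := x)) => //; first exact: maximal_submodule.
by rewrite ideal_mul_roi //; apply: maximal_submodule.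
Qed.

Lemma maximal_prod (A : Type) (r : seq A) (B : pred A) (F : A -> N) :
  (forall i, B i -> O (F i)) -> (forall i, B i -> ~ P (F i)) ->
  ~ P (\prod_(i <- r | B i) F i).
Proof.
move=> OF PF; suff [] : O (\prod_(i <- r | B i) F i) /\ ~ P (\prod_(i <- r | B i) F i) by [].
elim/big_ind: _ => [|x y [Ox Px] [Oy Py]|i Bi].
- by split; [apply: roi1 | apply: maximal_neq1].
- by split; [apply: roiM | move=> /(maximal_prime Ox Oy)[]].
- by split; [apply: OF | apply: PF].
Qed.

Variable p : nat.
Hypotheses (p_prime : prime p) (Pp : P p%:R).

Lemma maximal_int (z : int) : P z%:~R -> (p %| z)%Z.
Proof.
move=> Pz; apply/negPn/negP => npz; apply: maximal_neq1.
apply: (subgroup_cancel_int p_prime (submodule_subgroup maximal_submodule) npz).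
  by rewrite mulr1.
by rewrite mulr1.
Qed.

(** The quotient of O by P is a vector space of finite dimension over F_p. *)
Lemma maximal_has_norm : exists2 k, (0 < k)%N & has_norm K P (p ^ k).
Proof.
have gP := submodule_subgroup maximal_submodule.
have gO := submodule_subgroup (submodule_roi K).
have [_ _ PM] := maximal_submodule.
have [k [x [Ox xind xspan]]] := subgroup_modp_basis p_prime gO gP
  (fun y Oy => eq_ind_r P (PM _ _ Oy Pp) (mulrC _ _)).
exists k.
  case: k x Ox xind xspan => // x _ _ /(_ 1 (roi1 K))[c].
  by rewrite big_ord0 subr0 => /maximal_neq1.
pose F (c : {ffun 'I_k -> 'I_p}) := [set y | O y /\ P (y - \sum_i (c i)%:R * x i)].
have OF (c : {ffun 'I_k -> 'I_p}) : O (\sum_i (c i)%:R * x i).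
  by apply: roi_sum => i _; apply: roiM => //; apply: roi_nat.
have -> : has_norm K P (p ^ k) = ([set F c | c in setT] #= `I_(p ^ k))%card.
  congr (_ #= _)%card; apply/seteqP; split=> [_ [y Oy <-]|_ [c _ <-]]; last first.
    by exists (\sum_i (c i)%:R * x i).
  have [c Pc] := xspan y Oy; exists c => //.
  apply/seteqP; split=> z /= [Oz Pz]; split=> //.
    have -> : z - y = z - \sum_i (c i)%:R * x i - (y - \sum_i (c i)%:R * x i) by ring.
    exact: subgroupB.
  have -> : z - \sum_i (c i)%:R * x i = z - y + (y - \sum_i (c i)%:R * x i) by ring.
  exact: subgroupD.
have Finj : injective F.
  move=> c d Fcd; apply/ffunP => i; apply/val_inj => /=.
  have [_ Pcd] : F d (\sum_i (c i)%:R * x i).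
    by rewrite -Fcd; split=> //; rewrite subrr; apply: subgroup0.
  have /(_ i) : forall i, (p %| (c i : int) - (d i : int))%Z.
    apply: xind; move: Pcd; rewrite -sumrB; congr (P _); apply: eq_bigr => j _.
    by rewrite -mulrBl rmorphB.
  rewrite -eqz_mod_dvd !modz_nat eqz_nat !modn_small // => /eqP //.
apply: (card_eq_trans (inj_card_eq (in2W Finj))).
pose rk (c : {ffun 'I_k -> 'I_p}) : nat := enum_rank c.
have rk_inj : injective rk by move=> c d /val_inj/enum_rank_inj.
have := inj_card_eq (A := [set: {ffun 'I_k -> 'I_p}]) (in2W rk_inj).
rewrite card_eq_sym => /card_eq_trans; apply.
have -> : (p ^ k)%N = #|{ffun 'I_k -> 'I_p}| by rewrite card_ffun !card_ord.
suff -> : `I_#|{ffun 'I_k -> 'I_p}| = [set rk x | x in setT] by apply: card_eqxx.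
apply/seteqP; split=> [m /= ltm|_ [c _ <-]]; last exact: ltn_ord.
by exists (enum_val (Ordinal ltm)); rewrite // /rk enum_valK.
Qed.

(** P is generated by p and by lifts of a basis of P modulo p O. *)
Lemma maximal_finitely_generated : exists s : seq N, {in s, forall x, P x} /\
  forall I, submodule K I -> {in s, forall x, I x} -> P `<=` I.
Proof.
have gP := submodule_subgroup maximal_submodule.
have gpO : subgroup (ideal_scale p%:R O).
  split; first by exists 0; [apply: roi0 | rewrite mulr0].
  by move=> _ _ [x Ox <-] [y Oy <-]; exists (x - y); [apply: roiB | rewrite mulrBr].
have [k [x [Px _ xspan]]] := subgroup_modp_basis p_prime gP gpO
  (fun y Py => ex_intro2 _ _ y (maximal_sub Py) erefl).
exists (p%:R :: [seq x i | i <- enum 'I_k]); split=> [y|I sI sIx y Py].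
  by rewrite inE => /predU1P[->//|/mapP[i _ ->]].
have Ix i : I (x i) by apply: sIx; rewrite inE map_f ?orbT ?mem_enum.
have Ip : I p%:R by apply: sIx; rewrite inE eqxx.
have [c [z Oz zE]] := xspan y Py; have [_ ID IM] := sI.
rewrite -[y](subrK (\sum_i (c i)%:R * x i)) -zE; apply: ID.
  by rewrite mulrC; apply: IM.
by apply: submodule_sum => // i _; apply: IM => //; apply: roi_nat.
Qed.

End MaximalIdeals.

(** * Invertibility of the maximal ideals *)

Section MaximalInvertible.
Variables (N : fieldExtType rat) (K : {subfield N}).
Implicit Types (I J : set N) (x y a b : N).
Local Notation O := (ring_of_integers K).
Variables (P : set N) (p : nat).
Hypotheses (Pmax : maximal_ideal K P) (p_prime : prime p) (Pp : P p%:R).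

(** The local ring at P is a valuation ring.  Take q = (X - x) g with x = b / a
    a root of the integer polynomial q, some coefficient of which is prime to
    p: all the g_j and x g_j are integral, and if g_j or x g_j is outside P, it
    is the wanted s.  If all of them were in P, then so would be the
    coefficients q_j = g_(j-1) - x g_j. *)
Lemma maximal_compare a b : O a -> O b ->
  exists s, [/\ O s, ~ P s & (exists2 t, O t & s * b = t * a)
                          \/ (exists2 t, O t & s * a = t * b)].
Proof.
move=> Oa Ob; have [a0|a0] := eqVneq a 0.
  exists 1; split; [exact: roi1 | exact: (maximal_neq1 Pmax) | right].
  by exists 0; [exact: roi0 | rewrite a0 mulr0 mul0r].
pose x := b / a; have Kx : x \in K by apply: rpred_div; [case: Ob | case: Oa].
have xa : x * a = b by rewrite divfK.
have [c c0 [i ci]] := primitive_relation (fun i => x ^+ val i) p_prime (ltnSn _).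
pose q : {poly N} := \poly_(i < (\dim {:N}).+1) (oapp c 0 (insub i))%:~R.
have qE (j : 'I_(\dim {:N}).+1) : q`_j = (c j)%:~R.
  by rewrite coef_poly ltn_ord valK.
have qZ j : exists z : int, q`_j = z%:~R.
  by rewrite coef_poly; case: ifP => _; [eexists | exists 0].
have qK : q \is a polyOver K.
  by apply/polyOverP => j; have [z ->] := qZ j; case: (roi_int K z).
have qx : root q x.
  apply/rootP; rewrite horner_poly -[RHS]c0; apply: eq_bigr => j _.
  by rewrite valK.
pose g := q %/ ('X - x%:P).
have qg : q = g * ('X - x%:P) by rewrite divpK // dvdp_XsubCl.
have gZ j : integralOver (intr : int -> N) (g * ('X - x%:P))`_j.
  by rewrite -qg; have [z ->] := qZ j; apply: integral_id.
have gK : g \is a polyOver K by rewrite divp_polyOver // polyOverXsubC.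
have Og j : O g`_j.
  by split; [move/polyOverP: gK; apply | apply: integral_quotient gZ j].
have Oxg j : O (x * g`_j).
  by split; [rewrite rpredM //; case: (Og j) | apply: integral_quotient_root gZ j].
have [[j Pgj]|Pg] := pselect (exists j, ~ P g`_j).
  exists g`_j; split=> //; left; exists (x * g`_j) => //.
  by rewrite -xa mulrCA mulrA.
have [[j Pxgj]|Pxg] := pselect (exists j, ~ P (x * g`_j)).
  exists (x * g`_j); split=> //; right; exists g`_j => //.
  by rewrite -xa mulrAC mulrC.
case/negP: ci; apply: (maximal_int Pmax p_prime Pp).
rewrite -qE qg mulrBr coefB coefMX coefMC [_ * x]mulrC.
have gP := submodule_subgroup (maximal_submodule Pmax).
apply: subgroupB => //; last by apply: contrapT => H; apply: Pxg; exists i.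
case: ifP => _; first exact: subgroup0.
by apply: contrapT => H; apply: Pg; exists (val i).-1.
Qed.

(** g is an element of least valuation at P. *)
Lemma maximal_locally_principal (x0 : N) (s : seq N) :
    (forall x, x \in x0 :: s -> O x) ->
  exists2 g, g \in x0 :: s & exists u, [/\ O u, ~ P u
     & forall x, x \in x0 :: s -> exists2 t, O t & u * x = t * g].
Proof.
elim: s => [|y s IHs] Os.
  exists x0; rewrite ?mem_head //; exists 1.
  split; [exact: roi1 | exact: (maximal_neq1 Pmax) |].
  by move=> x; rewrite inE => /eqP->; exists 1; [apply: roi1|].
have perm x : x \in [:: x0, y & s] = (x == y) || (x \in x0 :: s).
  by rewrite !inE orbCA.
have [|g sg [u [Ou Pu uP]]] := IHs.
  by move=> x sx; apply: Os; rewrite perm sx orbT.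
have Og : O g by apply: Os; rewrite perm sg orbT.
have Oy : O y by apply: Os; rewrite perm eqxx.
have [v [Ov Pv gy]] := maximal_compare Og Oy.
have Ouv : O (u * v) by apply: roiM.
have Puv : ~ P (u * v) by move=> /(maximal_prime Pmax Ou Ov)[].
case: gy => [][t Ot vt].
  exists g; first by rewrite perm sg orbT.
  exists (u * v); split=> // x; rewrite perm => /predU1P[->|/uP[w Ow uw]].
    by exists (u * t); [apply: roiM | rewrite -mulrA vt mulrA].
  by exists (v * w); [apply: roiM | rewrite mulrAC uw; ring].
exists y; first by rewrite perm eqxx.
exists (u * v); split=> // x; rewrite perm => /predU1P[->|/uP[w Ow uw]].
  by exists (u * v).
exists (w * t); first exact: roiM.
by rewrite -[RHS]mulrA -vt mulrAC uw; ring.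
Qed.

(** P being finitely generated, the local comparison of its generators gives g
    in P and u outside P such that uP lies in gO; then u / g belongs to the
    inverse of P, so that P times its inverse contains both P and u. *)
Lemma maximal_invertible : invertible_ideal K P.
Proof.
have [P0 PD PM] := maximal_submodule Pmax.
have p0 : p%:R != 0 :> N by rewrite natrN_neq0 // prime_gt0.
have PK : P `<=` [set x | x \in K] by move=> x /(maximal_sub Pmax)[].
have fP : fractional_ideal K P.
  split=> //; exists 1; rewrite oner_eq0 ideal_scale1; split=> //; first exact: roi1.
  exact: maximal_sub.
split=> //; exists (ideal_inv K P).
  split; [|by move=> x []|].
  - split.
    + by split; [exact: mem0v | move=> _ [x _ <-]; rewrite mul0r; apply: roi0].
    + move=> x y [Kx xP] [Ky yP]; split; first exact: memvD.
      by move=> _ [z Pz <-]; rewrite mulrDl; apply: roiD; [apply: xP | apply: yP]; exists z.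
    + move=> a x Oa [Kx xP]; split; first by rewrite rpredM //; case: Oa.
      by move=> _ [z Pz <-]; rewrite -mulrA; apply: roiM => //; apply: xP; exists z.
  - exists p%:R; split=> //; first exact: roi_nat.
    by move=> _ [x [Kx xP] <-]; apply: xP; exists p%:R; rewrite // mulrC.
have iPJ : integral_ideal K (ideal_mul P (ideal_inv K P)).
  split; first by rewrite ideal_mulC; apply: submodule_mulr; apply: maximal_submodule.
  apply: ideal_mul_sub; [exact: roi0 | exact: roiD |].
  by move=> x y Px [_ yP]; apply: yP; exists x; rewrite // mulrC.
have PPJ : P `<=` ideal_mul P (ideal_inv K P).
  move=> x Px; rewrite -[x]mulr1; apply: ideal_mul_in => //; split; first exact: mem1v.
  by rewrite ideal_scale1; apply: maximal_sub.
have [_ _ /(_ _ iPJ PPJ)[PJP|//]] := Pmax.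
have [s [sP sgen]] := maximal_finitely_generated Pmax p_prime Pp.
have ps x : x \in p%:R :: s -> P x by rewrite inE => /predU1P[->|/sP].
have [|g /ps Pg [u [Ou Pu ug]]] := @maximal_locally_principal p%:R s.
  by move=> x /ps/(maximal_sub Pmax).
have u0 : u != 0 by apply/eqP => u0; apply: Pu; rewrite u0.
have g0 : g != 0.
  have [t _ utg] := ug _ (mem_head _ _); apply/eqP => g0; move/eqP: utg.
  by rewrite g0 mulr0 mulf_eq0 (negPf u0) (negPf p0).
case: Pu; rewrite -PJP -[u](divfK g0) mulrC; apply: ideal_mul_in => //.
split; first by apply: rpred_div; [case: Ou | apply: PK].
move=> _ [x Px <-]; pose I := [set x | O (u / g * x)].
apply: (sgen I) x Px => [|x sx].
  split=> [|x y Ix Iy|a x Oa Ix]; rewrite /I /=.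
  - by rewrite mulr0; apply: roi0.
  - by rewrite mulrDr; apply: roiD.
  - by rewrite mulrCA; apply: roiM.
have [|t Ot utg] := ug x; first by rewrite inE sx orbT.
by rewrite /I /= mulrAC utg mulfK.
Qed.

End MaximalInvertible.

(** * Ideal arithmetic and prime avoidance *)

Section IdealArithmetic.
Variables (N : fieldExtType rat) (K : {subfield N}).
Implicit Types (I J A B P Q : set N) (x y : N) (s : seq (set N)) (m n : nat).
Local Notation O := (ring_of_integers K).

Lemma ideal_mul_mono I I' J J' :
  I `<=` I' -> J `<=` J' -> ideal_mul I J `<=` ideal_mul I' J'.
Proof.
move=> II' JJ'; apply: ideal_mul_sub; [exact: ideal_mul0 | exact: ideal_mulD |].
by move=> x y /II' I'x /JJ' J'y; apply: ideal_mul_in.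
Qed.

Lemma ideal_roi_mul I : submodule K I -> ideal_mul O I = I.
Proof. by rewrite ideal_mulC; apply: ideal_mul_roi. Qed.

Lemma ideal_scale_mul a b I J :
  ideal_mul (ideal_scale a I) (ideal_scale b J) = ideal_scale (a * b) (ideal_mul I J).
Proof. by rewrite ideal_scale_mull ideal_scale_mulr ideal_scaleA. Qed.

Lemma ideal_scale_submodule a I : submodule K I -> submodule K (ideal_scale a I).
Proof.
move=> [I0 ID IM]; split; first by exists 0; rewrite ?mulr0.
  by move=> _ _ [x Ix <-] [y Iy <-]; exists (x + y); rewrite ?mulrDr //; apply: ID.
by move=> b _ Ob [x Ix <-]; exists (b * x); rewrite 1?mulrCA //; apply: IM.
Qed.

Lemma invertible_submodule I : invertible_ideal K I -> submodule K I.
Proof. by case=> [[]]. Qed.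

Lemma ideal_mul_cancel I A B : invertible_ideal K I ->
  submodule K A -> submodule K B ->
  ideal_mul I A `<=` ideal_mul I B -> A `<=` B.
Proof.
move=> /invertible_inv[_ JI] sA sB IAB.
rewrite -(ideal_roi_mul sA) -(ideal_roi_mul sB) -JI -!ideal_mulA.
exact: ideal_mul_mono.
Qed.

Lemma integral_mul_ideal I J :
  integral_ideal K I -> integral_ideal K J -> integral_ideal K (ideal_mul I J).
Proof.
move=> [_ IO] [sJ JO]; split; first exact: submodule_mulr.
by apply: ideal_mul_sub; [exact: roi0 | exact: roiD | move=> x y /IO Ox /JO; apply: roiM].
Qed.

Lemma integral_roi : integral_ideal K O.
Proof. by split=> //; apply: submodule_roi. Qed.

Definition ideal_pow I n : set N := iter n (ideal_mul I) O.

Lemma ideal_powS I n : ideal_pow I n.+1 = ideal_mul I (ideal_pow I n).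
Proof. by []. Qed.

Lemma submodule_pow I n : submodule K (ideal_pow I n).
Proof. by elim: n => [|n IHn]; [apply: submodule_roi | apply: submodule_mulr]. Qed.

Lemma ideal_pow1 I : submodule K I -> ideal_pow I 1 = I.
Proof. exact: ideal_mul_roi. Qed.

Lemma ideal_powD I m n :
  ideal_pow I (m + n) = ideal_mul (ideal_pow I m) (ideal_pow I n).
Proof.
elim: m => [|m IHm]; first by rewrite ideal_roi_mul //; apply: submodule_pow.
by rewrite addSn !ideal_powS IHm ideal_mulA.
Qed.

Lemma ideal_powM I m n : ideal_pow I (m * n) = ideal_pow (ideal_pow I m) n.
Proof.
by elim: n => [|n IHn]; rewrite ?muln0 // mulnS ideal_powD IHn.
Qed.

Lemma ideal_pow_scale a n :
  ideal_pow (ideal_scale a O) n = ideal_scale (a ^+ n) O.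
Proof.
elim: n => [|n IHn]; first by rewrite expr0 ideal_scale1.
by rewrite ideal_powS IHn ideal_scale_mul exprS ideal_mul_roi //; apply: submodule_roi.
Qed.

Lemma integral_pow I n : integral_ideal K I -> integral_ideal K (ideal_pow I n).
Proof. by move=> iI; elim: n => [|n]; [apply: integral_roi | apply: integral_mul_ideal]. Qed.

Lemma invertible_pow I n : invertible_ideal K I -> invertible_ideal K (ideal_pow I n).
Proof. by move=> iI; elim: n => [|n]; [apply: invertible_roi | apply: invertible_mul]. Qed.

Lemma ideal_pow_anti I m n :
  integral_ideal K I -> (m <= n)%N -> ideal_pow I n `<=` ideal_pow I m.
Proof.
move=> iI /subnKC <-; rewrite ideal_powD -{2}(ideal_mul_roi (submodule_pow I m)).
by apply: ideal_mul_mono => //; have [] := integral_pow (n - m) iI.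
Qed.

(** Cancelling I^m in I^m <= I^n with m < n would give 1 in I. *)
Lemma ideal_pow_leq I m n : invertible_ideal K I -> integral_ideal K I -> ~ I 1 ->
  ideal_pow I m `<=` ideal_pow I n -> (n <= m)%N.
Proof.
move=> vI iI I1 mn; rewrite leqNgt; apply/negP => /subnKC nE; apply: I1.
have [sI _] := iI.
suff : O `<=` ideal_pow I (n - m.+1).+1.
  move=> /(_ _ (roi1 K)); rewrite -[X in _ -> X 1](ideal_pow1 sI).
  exact: ideal_pow_anti.
apply: (ideal_mul_cancel (invertible_pow m vI)).
- exact: submodule_roi.
- exact: submodule_pow.
- by rewrite ideal_mul_roi -?ideal_powD -?addSnnS ?nE //; apply: submodule_pow.
Qed.

Lemma ideal_pow_inj I m n : invertible_ideal K I -> integral_ideal K I -> ~ I 1 ->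
  ideal_pow I m = ideal_pow I n -> m = n.
Proof.
move=> vI iI I1 E; apply/eqP.
by rewrite eqn_leq !(@ideal_pow_leq I) // E.
Qed.

(** z is a product of elements of the various Q outside P. *)
Lemma maximal_separate P s : maximal_ideal K P ->
    {in s, forall Q, maximal_ideal K Q} -> P \notin s ->
  exists z, [/\ O z, ~ P z & {in s, forall Q, Q z}].
Proof.
move=> Pmax; elim: s => [|Q s IHs] smax.
  by move=> _; exists 1; split=> //; [apply: roi1 | apply: (maximal_neq1 Pmax)].
rewrite inE negb_or => /andP[PQ Ps].
have Qmax : maximal_ideal K Q by apply: smax; rewrite mem_head.
have {IHs} [|//|z [Oz Pz sz]] := IHs; first by move=> R sR; apply: smax; rewrite inE sR orbT.
have [w Qw Pw] : exists2 w, Q w & ~ P w.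
  apply: contrapT => Hex; case/negP: PQ; apply/eqP.
  have [|//|PO] := (let: And3 _ _ H := Qmax in H) P (maximal_integral Pmax).
    by move=> w Qw; apply: contrapT => Pw; apply: Hex; exists w.
  by have [_ + _] := Pmax.
have Ow := maximal_sub Qmax Qw.
exists (w * z); split; first exact: roiM.
  by move=> /(maximal_prime Pmax Ow Oz)[].
move=> R; rewrite inE => /predU1P[->|sR].
  by rewrite mulrC; have [_ _] := maximal_submodule Qmax; apply.
have [|_ _] := @maximal_submodule _ K R; last by apply=> //; apply: sz.
by apply: smax; rewrite inE sR orbT.
Qed.

(** Prime avoidance, applied below with A P = P and with A P = P I.  If x
    avoids A Q for the other Q but lies in A P, then so does not x + z y, where
    y is in I outside A P, and z is in all the other Q but not in P. *)
Lemma maximal_avoidance I (A : set N -> set N) s :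
    submodule K I -> {in s, forall P, maximal_ideal K P} ->
    {in s, forall P, [/\ submodule K (A P), ideal_mul P I `<=` A P
                       & exists2 y, I y & ~ A P y]} ->
  exists2 x, I x & {in s, forall P, ~ A P x}.
Proof.
move=> sI; have [I0 ID IM] := sI; elim: s => [|P s IHs] smax sA.
  by exists 0.
have {IHs} [Q sQ|Q sQ|x Ix Ax] := IHs.
- by apply: smax; rewrite inE sQ orbT.
- by apply: sA; rewrite inE sQ orbT.
have [sP|sP] := boolP (P \in s).
  by exists x => // Q; rewrite inE => /predU1P[->|]; apply: Ax.
have Pmax : maximal_ideal K P by apply: smax; rewrite mem_head.
have [sAP PA [y Iy APy]] := sA _ (mem_head _ _).
have [APx|APx] := pselect (A P x); last first.
  by exists x => // Q; rewrite inE => /predU1P[->//|]; apply: Ax.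
have smax' : {in s, forall Q, maximal_ideal K Q}.
  by move=> Q sQ; apply: smax; rewrite inE sQ orbT.
have [z [Oz Pz sz]] := maximal_separate Pmax smax' sP.
exists (x + z * y); first by apply: ID => //; apply: IM.
move=> Q; rewrite inE => /predU1P[->|sQ] Axzy.
  apply/APy/(maximal_mul_notin Pmax sAP PA Iy Oz Pz).
  have -> : z * y = x + z * y - x by ring.
  exact: (subgroupB (submodule_subgroup sAP)).
have [|sAQ QA _] := sA Q; first by rewrite inE sQ orbT.
apply: (Ax Q sQ); rewrite -[x](addrK (z * y)).
apply: (subgroupB (submodule_subgroup sAQ)) => //; apply/QA/ideal_mul_in => //.
exact: sz.
Qed.

Lemma maximal_prod_ideal s : uniq s -> {in s, forall P, maximal_ideal K P} ->
  \big[@ideal_mul N/O]_(P <- s) P = [set x | O x /\ {in s, forall P, P x}].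
Proof.
elim: s => [|P s IHs] /=; first by rewrite big_nil => *; apply/seteqP; split=> x //= [].
move=> /andP[Ps us] smax; rewrite big_cons IHs //; last first.
  by move=> Q sQ; apply: smax; rewrite inE sQ orbT.
have Pmax : maximal_ideal K P by apply: smax; rewrite mem_head.
have smax' : {in s, forall Q, maximal_ideal K Q}.
  by move=> Q sQ; apply: smax; rewrite inE sQ orbT.
have sub Q : Q \in P :: s -> submodule K Q by move=> /smax/maximal_submodule.
apply/seteqP; split.
  apply: ideal_mul_sub.
  - by split=> [|Q /sub[]]; [apply: roi0|].
  - move=> x y [Ox sx] [Oy sy]; split=> [|Q sQ]; first exact: roiD.
    by have [_ QD _] := sub Q sQ; apply: QD; [apply: sx | apply: sy].
  - move=> x y Px [Oy sy]; have Ox := maximal_sub Pmax Px.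
    split=> [|Q sQ]; first exact: roiM.
    have [_ _ QM] := sub Q sQ; move: sQ; rewrite inE => /predU1P[QP|sQ].
      by rewrite mulrC; apply: QM => //; rewrite QP.
    by apply: QM => //; apply: sy.
move=> x [Ox sx]; have Px : P x by apply: sx; rewrite mem_head.
have [z [Oz Pz sz]] := maximal_separate Pmax smax' Ps.
have [a Oa Paz] := maximal_comax Pmax Oz Pz.
(* a z is in the other ideals, and 1 - a z is in P. *)
have -> : x = x * (a * z) + (1 - a * z) * x by ring.
apply: ideal_mulD; apply: ideal_mul_in => //.
  split=> [|Q sQ]; first exact: roiM.
  have [|_ _ QM] := sub Q; first by rewrite inE sQ orbT.
  by apply: QM => //; apply: sz.
by split=> // Q sQ; apply: sx; rewrite inE sQ orbT.
Qed.

Lemma invertible_prod_ideal s : {in s, forall P, invertible_ideal K P} ->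
  invertible_ideal K (\big[@ideal_mul N/O]_(P <- s) P).
Proof.
move=> sI; rewrite big_seq; elim/big_ind: _ => //.
- exact: invertible_roi.
- by move=> I J; apply: invertible_mul.
Qed.

End IdealArithmetic.

(** * Galois action on the maximal ideals *)

Section GaloisAction.
Variable N : splittingFieldType rat.
Implicit Types (K L : {subfield N}) (I J P Q : set N) (x y : N) (s t : 'AEnd(N)).

Lemma aut_inverse s : exists t, cancel s t /\ cancel t s.
Proof.
have s0 : lker s == 0%VS := kAutf_lker0 (k1AHom fullv s).
by exists (inv_ahom s); split=> x /=; [apply: lker0_lfunK | apply: lker0_lfunVK].
Qed.

Lemma aut_normal K s : galois 1%AS K -> (s @: K)%VS = K.
Proof.
move=> /and3P[_ _ /'forall_implyP/(_ s)].
by rewrite inE kAut1E subvf => /(_ isT)/eqP.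
Qed.

Lemma aut_integral s x :
  integralOver (intr : int -> N) x -> integralOver (intr : int -> N) (s x).
Proof.
move=> [q qm qx]; exists q => //; rewrite -(fmorph_root s) -map_poly_comp in qx.
by rewrite (eq_map_poly (g := (intr : int -> N))) // in qx => z /=; rewrite rmorph_int.
Qed.

Lemma aut_roi K s x : galois 1%AS K -> ring_of_integers K x -> ring_of_integers K (s x).
Proof.
move=> gK [Kx ix]; split; last exact: aut_integral.
by rewrite -(aut_normal s gK) memv_img.
Qed.

Lemma aut_integral_ideal K s I :
  galois 1%AS K -> integral_ideal K I -> integral_ideal K (s @` I).
Proof.
move=> gK [[I0 ID IM] IO]; have [t [st ts]] := aut_inverse s; split.
  split; first by exists 0; rewrite ?rmorph0.
    by move=> _ _ [x Ix <-] [y Iy <-]; exists (x + y); rewrite ?rmorphD //; apply: ID.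
  move=> a _ Oa [x Ix <-]; exists (t a * x); last by rewrite rmorphM /= ts.
  by apply: IM => //; apply: aut_roi.
by move=> _ [x /IO Ox <-]; apply: aut_roi.
Qed.

Lemma image_cancel s t I : cancel s t -> t @` (s @` I) = I.
Proof.
move=> st; apply/seteqP; split=> [_ [_ [x Ix <-] <-]|x Ix]; first by rewrite st.
by exists (s x); rewrite ?st //; exists x.
Qed.

Lemma aut_image_roi K s : galois 1%AS K -> s @` ring_of_integers K = ring_of_integers K.
Proof.
move=> gK; have [t [st ts]] := aut_inverse s; apply/seteqP; split.
  by move=> _ [x Ox <-]; apply: aut_roi.
by move=> x Ox; exists (t x); rewrite ?ts //; apply: aut_roi.
Qed.

Lemma aut_maximal K s P : galois 1%AS K -> maximal_ideal K P -> maximal_ideal K (s @` P).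
Proof.
move=> gK [iP PO Pmax]; have [t [st ts]] := aut_inverse s; split.
- exact: aut_integral_ideal.
- by move=> sPO; apply: PO; rewrite -(image_cancel P st) sPO aut_image_roi.
- move=> I iI PI; case: (Pmax (t @` I)).
  + exact: aut_integral_ideal.
  + by rewrite -(image_cancel P st); apply: image_subset.
  + by move=> tI; left; rewrite -tI image_cancel.
  + by move=> tI; right; rewrite -(image_cancel I ts) tI aut_image_roi.
Qed.

Lemma aut_has_norm K s P q :
  galois 1%AS K -> has_norm K P q -> has_norm K (s @` P) q.
Proof.
move=> gK; rewrite /has_norm; have [t [st ts]] := aut_inverse s.
have -> : residue_classes K (s @` P) = [set s @` C | C in residue_classes K P].
  have imC x : s @` [set y | ring_of_integers K y /\ P (y - x)]
      = [set y | ring_of_integers K y /\ (s @` P) (y - s x)].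
    apply/seteqP; split=> [_ [y [Oy Py] <-]|y /= [Oy [z Pz zE]]].
      by split; [apply: aut_roi | exists (y - x); rewrite ?rmorphB].
    exists (t y); last by rewrite ts.
    split; first exact: aut_roi.
    suff -> : t y - x = z by [].
    by rewrite -[z]st zE rmorphB /= st.
  apply/seteqP; split=> [_ [x Ox <-]|_ [_ [x Ox <-] <-]].
    exists [set y | ring_of_integers K y /\ P (y - t x)].
      by exists (t x) => //; apply: aut_roi.
    by rewrite imC ts.
  by exists (s x); [apply: aut_roi | rewrite imC].
apply: card_eq_trans; apply: inj_card_eq => A B _ _ AB.
by rewrite -(image_cancel A st) AB image_cancel.
Qed.

Lemma roi_galNorm K L x : galois K L -> galois 1%AS L -> ring_of_integers L x ->
  ring_of_integers K (galNorm K L x).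
Proof.
move=> gKL gL [Lx ix]; split; first exact: mem_galNorm.
rewrite /galNorm; elim/big_ind: _ => [|y z|s _]; [exact: integral1 | exact: integral_mul |].
exact: aut_integral.
Qed.

Definition primes_above K (p : nat) : set (set N) :=
  [set P | maximal_ideal K P /\ P p%:R].

Section Above.
Variables (K : {subfield N}) (p : nat).
Hypotheses (gK : galois 1%AS K) (p_prime : prime p).
Local Notation O := (ring_of_integers K).

(** If Q were none of the conjugates of P, prime avoidance would give x in Q
    outside all of them; then the norm of x would be an integer of Q, hence a
    multiple of p, so in P, but a product of elements outside P. *)
Lemma primes_above_conjugate P Q : primes_above K p P -> primes_above K p Q ->
  exists2 s : gal_of K, s \in 'Gal(K / 1)%g & Q = s @` P.
Proof.
move=> [Pmax Pp] [Qmax Qp]; apply: contrapT => noconj.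
pose r := [seq gal_repr g @` P | g <- enum 'Gal(K / 1)%g].
have rP R : R \in r -> exists2 s : gal_of K, s \in 'Gal(K / 1)%g & R = s @` P.
  by move=> /mapP[s]; rewrite mem_enum => ? ->; exists s.
have rmax : {in r, forall R, maximal_ideal K R}.
  by move=> R /rP[s _ ->]; apply: aut_maximal.
have sQ := maximal_submodule Qmax.
have [|x Qx xr] := @maximal_avoidance _ K Q id r sQ rmax.
  move=> R rR; have Rmax := rmax R rR; split; first exact: (maximal_submodule Rmax).
    move=> x QRx; rewrite -(ideal_mul_roi (maximal_submodule Rmax)).
    by apply: ideal_mul_mono QRx => //; apply: (maximal_sub Qmax).
  apply: contrapT => QR; have [s Gs RE] := rP R rR; apply: noconj; exists s => //.
  rewrite -RE; have [_ _ /(_ R (maximal_integral Rmax))[|//|]] := Qmax.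
    by move=> y Qy; apply: contrapT => Ry; apply: QR; exists y.
  by have [_ + _] := Rmax.
have Ox := maximal_sub Qmax Qx.
have galG (s : gal_of K) y : y \in K -> (s^-1)%g (s y) = y.
  by move=> Ky; rewrite -galM // mulgV gal_id.
have [z zE] : exists z : int, galNorm 1 K x = z%:~R.
  by have [N1 iN] := roi_galNorm gK gK Ox; apply: rational_integral.
have Pz : P z%:~R.
  suff /(maximal_int Qmax p_prime Qp)/dvdzP[w ->] : Q z%:~R.
    rewrite intrM; have [_ _ PM] := maximal_submodule Pmax.
    by apply: PM => //; apply: roi_int.
  rewrite -zE /galNorm (bigD1 1%g) ?group1 //= gal_id mulrC.
  have [_ _] := maximal_submodule Qmax; apply=> //.
  by apply: roi_prod => s _; apply: aut_roi.
move: Pz; rewrite -zE; apply: (maximal_prod Pmax) => s Gs; first exact: aut_roi.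
move=> Psx; apply: (xr ((s^-1)%g @` P)).
  by apply/mapP; exists (s^-1)%g; rewrite // mem_enum groupV.
by exists (s x) => //; apply: galG; case: Ox.
Qed.

Lemma primes_above_finite : finite_set (primes_above K p).
Proof.
have [[P PP]|noP] := pselect (exists P, primes_above K p P); last first.
  suff -> : primes_above K p = set0 by apply: finite_set0.
  by apply/seteqP; split=> // P PP; apply: noP; exists P.
apply: sub_finite_set (finite_seq [seq gal_repr g @` P | g <- enum 'Gal(K / 1)%g]).
move=> Q QQ /=; have [s Gs ->] := primes_above_conjugate PP QQ.
by apply/mapP; exists s; rewrite // mem_enum.
Qed.

Lemma exists_primes_above : exists P, primes_above K p P.
Proof.
have iI : integral_ideal K (ideal_scale p%:R O).
  split; first exact/ideal_scale_submodule/submodule_roi.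
  by move=> _ [x Ox <-]; apply: roiM => //; apply: roi_nat.
have [[x [_ ix] px]|P Pmax IP] := exists_maximal_ideal iI; last first.
  by exists P; split=> //; apply: IP; exists 1; rewrite ?mulr1 //; apply: roi1.
have p0 : p%:R != 0 :> N by rewrite natrN_neq0 // prime_gt0.
have xE : x = p%:R^-1 by apply: (mulfI p0); rewrite px divff.
have [|z zE] := rational_integral _ ix.
  by rewrite xE rpredV rpred_nat.
have : p%:R * z%:~R = 1 :> N by rewrite -zE.
rewrite -[p%:R]/(p%:~R) -intrM => /(@intrN_inj N _ 1) pz1.
have : (p %| 1)%Z by apply/dvdzP; exists z; rewrite mulrC pz1.
by rewrite dvdzE /= dvdn1 => /eqP p1; move: p_prime; rewrite p1.
Qed.

End Above.

Lemma maximal_natX K P m k : maximal_ideal K P -> P (m ^ k)%N%:R -> P m%:R.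
Proof.
move=> Pmax; elim: k => [/(maximal_neq1 Pmax)//|k IHk].
rewrite expnS natrM => /(maximal_prime Pmax)[]//; exact: roi_nat.
Qed.

Lemma maximal_prime_nat K P n : maximal_ideal K P -> (0 < n)%N -> P n%:R ->
  exists2 p, prime p & P p%:R.
Proof.
move=> Pmax; have [m] := ubnP n; elim: m n => // m IHm n lenm n0 Pn.
have [n1|n1] := leqP n 1.
  have nE : n = 1%N by apply/eqP; rewrite eqn_leq n1.
  by case: (maximal_neq1 Pmax); rewrite nE in Pn.
have := divnK (pdiv_dvd n) => nE; rewrite -nE natrM in Pn.
have [||Pd|] := maximal_prime Pmax _ _ Pn; try exact: roi_nat.
  have dn : (n %/ pdiv n < n)%N by rewrite ltn_Pdiv // prime_gt1 ?pdiv_prime.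
  apply: (IHm _ _ _ Pd); first exact: leq_trans dn _.
  by rewrite divn_gt0 ?pdiv_gt0 // dvdn_leq ?pdiv_dvd.
by exists (pdiv n); rewrite // pdiv_prime.
Qed.

(** Two of the q + 1 integers 0, ..., q are congruent modulo P, so P contains a
    positive integer, hence a prime p, and q is the order of a vector space
    over F_p. *)
Lemma has_norm_prime_power K P q : maximal_ideal K P -> has_norm K P q ->
  exists2 p, prime p & P p%:R /\ exists2 k, (0 < k)%N & q = (p ^ k)%N.
Proof.
move=> Pmax nP.
pose F (n : nat) : set N := [set y | ring_of_integers K y /\ P (y - n%:R)].
have gP := submodule_subgroup (maximal_submodule Pmax).
have [n n0 Pn] : exists2 n, (0 < n)%N & P n%:R.
  apply: contrapT => noP.
  have Finj : injective F.
    have lt_case m n : (m < n)%N -> F m = F n -> False.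
      move=> mn Fmn; apply: noP; exists (n - m)%N; first by rewrite subn_gt0.
      have [_] : F m n%:R.
        rewrite Fmn; split; first exact: roi_nat.
        by rewrite subrr; apply: subgroup0.
      by rewrite natrB // ltnW.
    move=> m n Fmn; have [/lt_case|/lt_case|//] := ltngtP m n; first by move/(_ Fmn).
    by move/(_ (esym Fmn)).
  have : (`I_q.+1 #<= `I_q)%card; last by rewrite card_le_II ltnn.
  rewrite -(card_le_eql (inj_card_eq (A := `I_q.+1) (in2W Finj))).
  rewrite -(card_le_eqr nP); apply: subset_card_le => _ [m _ <-].
  by exists m%:R => //; apply: roi_nat.
have [p pp Pp] := maximal_prime_nat Pmax n0 Pn; exists p => //; split=> //.
have [k k0 nk] := maximal_has_norm Pmax pp Pp; exists k => //.
by apply/card_eq_II; apply: card_eq_trans nk; rewrite card_eq_sym.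
Qed.

Section Pi.
Variable K : {subfield N}.
Hypothesis gK : galois 1%AS K.
Local Notation O := (ring_of_integers K).

(** The primes above p are conjugate, so they have the same norm, which is a
    power of p; hence the maximal ideals of norm q are none, or all the primes
    above some p. *)
Lemma norm_primes_above q :
  [set P | maximal_ideal K P /\ has_norm K P q] = set0 \/
  exists2 p, prime p &
    [set P | maximal_ideal K P /\ has_norm K P q] = primes_above K p.
Proof.
have [[P [Pmax nP]]|noP] := pselect (exists P, maximal_ideal K P /\ has_norm K P q);
  last by left; apply/seteqP; split=> // P PP; apply: noP; exists P.
right; have [p pp [Pp [k k0 qE]]] := has_norm_prime_power Pmax nP.
exists p => //; apply/seteqP; split=> Q [Qmax].
  move=> nQ; split=> //; have [p' pp' [Qp' [k' k0' qE']]] := has_norm_prime_power Qmax nQ.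
  suff -> : p = p' by [].
  have : p \in primes q by rewrite qE primesX // primes_prime // inE.
  by rewrite qE' primesX // primes_prime // inE => /eqP.
move=> Qp; split=> //.
have [s _ ->] := primes_above_conjugate gK pp (conj Pmax Pp) (conj Qmax Qp).
exact: aut_has_norm.
Qed.

Lemma primes_above_norm p : prime p -> exists2 q, (0 < q)%N &
  [set P | maximal_ideal K P /\ has_norm K P q] = primes_above K p.
Proof.
move=> pp; have [P [Pmax Pp]] := exists_primes_above K pp.
have [k k0 nP] := maximal_has_norm Pmax pp Pp.
exists (p ^ k)%N; first by rewrite expn_gt0 prime_gt0.
have [S0|[p' pp' SE]] := norm_primes_above (p ^ k).
  by have : set0 P by rewrite -S0.
suff pE : p' = p by rewrite SE pE.
have [_ Pp'] : primes_above K p' P by rewrite -SE.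
have := maximal_int Pmax pp Pp (z := p') Pp'.
by rewrite dvdzE /= dvdn_prime2 // => /eqP.
Qed.

Definition prod_primes_above (p : nat) : set N :=
  \big[@ideal_mul N/O]_(P <- fset_set (primes_above K p)) P.

Variables (p : nat) (p_prime : prime p).
Local Notation R := (prod_primes_above p).

Lemma prod_primes_aboveE : R = [set x | O x /\ forall P, primes_above K p P -> P x].
Proof.
have fS := primes_above_finite gK p_prime.
rewrite /prod_primes_above maximal_prod_ideal ?fset_uniq //.
  apply/seteqP; split=> x [Ox Px]; split=> // P PP; apply: Px.
    by rewrite in_fset_set // inE.
  by move: PP; rewrite in_fset_set // inE.
by move=> P; rewrite in_fset_set // inE => -[].
Qed.

Lemma prod_primes_above_invertible : invertible_ideal K R.
Proof.
apply: invertible_prod_ideal => P; rewrite in_fset_set ?inE => [[Pmax Pp]|].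
  exact: maximal_invertible Pmax p_prime Pp.
exact: primes_above_finite.
Qed.

Lemma prod_primes_above_integral : integral_ideal K R.
Proof.
split; last by rewrite prod_primes_aboveE => x [].
exact/invertible_submodule/prod_primes_above_invertible.
Qed.

Lemma prod_primes_above_sub P : primes_above K p P -> R `<=` P.
Proof. by rewrite prod_primes_aboveE => PP x [_]; apply. Qed.

Lemma prod_primes_above_neq1 : ~ R 1.
Proof.
have [P PP] := exists_primes_above K p_prime.
by move=> /(prod_primes_above_sub PP); apply: maximal_neq1 (let: conj H _ := PP in H).
Qed.

Lemma prod_primes_above_p : R p%:R.
Proof.
rewrite prod_primes_aboveE; split; first exact: roi_nat.
by move=> P [].
Qed.

Lemma aut_primes_above s P : primes_above K p P -> primes_above K p (s @` P).
Proof.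
move=> [Pmax Pp]; split; first exact: aut_maximal.
by exists p%:R; rewrite // rmorph_nat.
Qed.

Lemma prod_primes_above_aut s x : R x -> R (s x).
Proof.
rewrite prod_primes_aboveE => -[Ox Px]; split; first exact: aut_roi.
have [t [st ts]] := aut_inverse s.
move=> P PP; have [y Py yx] := Px _ (aut_primes_above t PP).
by rewrite -yx ts.
Qed.

End Pi.
End GaloisAction.

(** * Invariant ideals *)

Section InvariantIdeals.
Variable N : splittingFieldType rat.
Implicit Types (K L : {subfield N}) (I J P Q : set N) (x y : N) (s t : 'AEnd(N)).

(** An invariant ideal is equal to its images, the automorphisms being
    invertible. *)
Definition invariant I := forall s x, I x -> I (s x).

Lemma invariant_roi K : galois 1%AS K -> invariant (ring_of_integers K).
Proof. by move=> gK s x; apply: aut_roi. Qed.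

Lemma invariant_mul I J : invariant I -> invariant J -> invariant (ideal_mul I J).
Proof.
move=> vI vJ s; apply: (ideal_mul_sub (S := fun x => ideal_mul I J (s x))).
- by rewrite rmorph0; apply: ideal_mul0.
- by move=> x y; rewrite rmorphD; apply: ideal_mulD.
- by move=> x y Ix Jy; rewrite rmorphM; apply: ideal_mul_in; [apply: vI | apply: vJ].
Qed.

Lemma invariant_pow K I n :
  galois 1%AS K -> invariant I -> invariant (ideal_pow K I n).
Proof. by move=> gK vI; elim: n => [|n]; [apply: invariant_roi | apply: invariant_mul]. Qed.

Lemma invariant_inv K I : galois 1%AS K -> invariant I -> invariant (ideal_inv K I).
Proof.
move=> gK vI s x [Kx xI]; have [t [st ts]] := aut_inverse s.
split; first by rewrite -(aut_normal s gK) memv_img.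
move=> _ [y Iy <-]; rewrite -[y]ts -rmorphM; apply: aut_roi => //.
by apply: xI; exists (t y) => //; apply: vI.
Qed.

(** Take y i in I^i outside I^(i+1) for i <= dim N.  In an integer
    relation between the y i, if p is in I^(dim N + 1), the first y i whose
    coefficient is prime to p has to be in I^(i+1). *)
Lemma pow_notin_p K I p : prime p ->
  invertible_ideal K I -> integral_ideal K I -> ~ I 1 ->
  ~ ideal_pow K I (\dim {:N}).+1 p%:R.
Proof.
move=> pp vI iI I1 Ip; set m := (\dim {:N}).+1 in Ip.
have Ipow i : (i <= m)%N -> ideal_pow K I m `<=` ideal_pow K I i.
  exact: ideal_pow_anti.
have ex_y : forall i : 'I_m,
    exists2 y, ideal_pow K I i y & ~ ideal_pow K I i.+1 y.
  move=> i; apply: contrapT => noy.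
  suff /(ideal_pow_leq vI iI I1) : ideal_pow K I i `<=` ideal_pow K I i.+1.
    by rewrite ltnn.
  by move=> y Iy; apply: contrapT => yI; apply: noy; exists y.
have [y Iy yI] := all_sig2 (fun i => cid2 (ex_y i)).
have [c c0 [i0 ci0]] := primitive_relation y pp (ltnSn _).
suff H n (i : 'I_m) : (i < n)%N -> (p %| c i)%Z by rewrite (H m) in ci0.
elim: n i => // n IHn i; rewrite ltnS => lein.
have sJ := submodule_pow K I i.+1; have gJ := submodule_subgroup sJ.
have [_ _ JM] := sJ.
have Jp z : ring_of_integers K z -> ideal_pow K I i.+1 (p%:R * z).
  by move=> Oz; rewrite mulrC; apply: JM => //; apply: Ipow.
have Oy j : ring_of_integers K (y j) by have [_] := integral_pow j iI; apply.
have Jcy : ideal_pow K I i.+1 ((c i)%:~R * y i).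
  move: c0; rewrite (bigD1 i) //= => /eqP; rewrite addr_eq0 => /eqP->.
  apply: subgroupN => //; apply: subgroup_sum => // j ji.
  have [ltji|leij] := ltnP j i.
    have := IHn j (leq_trans ltji lein) => /divzK <-.
    by rewrite intrM -mulrA; apply: JM; [apply: roi_int | apply: Jp].
  apply: JM; first exact: roi_int.
  by apply: (ideal_pow_anti iI _ (Iy j)); rewrite ltn_neqAle leij eq_sym ji.
apply/negPn/negP => npc; apply: (yI i).
exact: (subgroup_cancel_int pp gJ npc Jcy (Jp _ (Oy i))).
Qed.

Section Powers.
Variables (K : {subfield N}) (p : nat).
Hypotheses (gK : galois 1%AS K) (p_prime : prime p).
Local Notation O := (ring_of_integers K).
Local Notation R := (prod_primes_above K p).

Let vR : invertible_ideal K R := prod_primes_above_invertible gK p_prime.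
Let iR : integral_ideal K R := prod_primes_above_integral gK p_prime.
Let R1 : ~ R 1 := prod_primes_above_neq1 gK p_prime.

Lemma prod_primes_above_invariant : invariant R.
Proof. by move=> s x; apply: prod_primes_above_aut. Qed.

(** A proper ideal I containing a power of p lies in a prime above p, and if
    I is invariant, then it lies in all of them, which are conjugate. *)
Lemma invariant_sub_primes I k : integral_ideal K I -> invariant I ->
  I (p ^ k)%:R -> I = O \/ I `<=` R.
Proof.
move=> iI invI Ipk; have [I1|I1] := pselect (I 1).
  by left; apply: integral_ideal_unit.
right; have [P Pmax IP] := exists_maximal_ideal iI I1.
have Pp : P p%:R by apply: (maximal_natX (k := k) Pmax); apply: IP.
move=> x Ix; rewrite prod_primes_aboveE //; split; first by case: iI => _; apply.
move=> Q QQ.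
have [g _ ->] := primes_above_conjugate gK p_prime (conj Pmax Pp) QQ.
have [t [st ts]] := aut_inverse g.
by exists (t x); [apply/IP/invI | rewrite ts].
Qed.

(** Divide I by R as long as the quotient is proper: by invariance it remains
    contained in R, so that I would be contained in all the powers of R. *)
Lemma invariant_power_bounded I k B : integral_ideal K I -> invariant I ->
  I (p ^ k)%:R -> ~ (I `<=` ideal_pow K R B) -> exists m, I = ideal_pow K R m.
Proof.
move=> iI invI Ipk IB; apply: contrapT => noI.
suff H m : I `<=` ideal_pow K R m by apply/IB/H.
elim: m => [|m IHm]; first by case: iI.
have vRm := invertible_pow m vR; have [viRm RmRm] := invertible_inv vRm.
pose J := ideal_mul (ideal_inv K (ideal_pow K R m)) I.
have sI : submodule K I by case: iI.
have IE : I = ideal_mul (ideal_pow K R m) J.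
  by rewrite /J ideal_mulA [ideal_mul (ideal_pow _ _ _) _]ideal_mulC RmRm ideal_roi_mul.
have iJ : integral_ideal K J.
  split; first exact: submodule_mulr.
  by rewrite -RmRm; apply: ideal_mul_mono.
have invJ : invariant J.
  apply: invariant_mul => //; apply: invariant_inv => //; apply: invariant_pow => //.
  exact: prod_primes_above_invariant.
have IJ : I `<=` J.
  rewrite /J -{1}(ideal_roi_mul sI); apply: ideal_mul_mono => // x Ox.
  split; first by case: Ox.
  have [[_ _ RM] RO] := integral_pow m iR.
  by move=> _ [y Ry <-]; apply: roiM => //; apply: RO.
have [JO|JR] := invariant_sub_primes iJ invJ (IJ _ Ipk).
  by case: noI; exists m; rewrite IE JO ideal_mul_roi //; apply: submodule_pow.
rewrite IE -addn1 ideal_powD ideal_pow1; last by case: iR.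
exact: ideal_mul_mono.
Qed.

Lemma p_eq_power : exists e, ideal_scale p%:R O = ideal_pow K R e.
Proof.
apply: (@invariant_power_bounded _ 1 (\dim {:N}).+1).
- split; first exact/ideal_scale_submodule/submodule_roi.
  by move=> _ [x Ox <-]; apply: roiM => //; apply: roi_nat.
- move=> s _ [x Ox <-]; rewrite rmorphM rmorph_nat.
  by exists (s x) => //; apply: aut_roi.
- by rewrite expn1; exists 1; [apply: roi1 | rewrite mulr1].
- move=> /(_ p%:R) H; apply: (pow_notin_p p_prime vR iR R1); apply: H.
  by exists 1; [apply: roi1 | rewrite mulr1].
Qed.

(** The powers of p O, which are powers of R, bound the exponent m. *)
Theorem invariant_power I k : integral_ideal K I -> invariant I ->
  I (p ^ k)%:R -> exists m, I = ideal_pow K R m.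
Proof.
move=> iI invI Ipk; have [e pE] := p_eq_power.
apply: (invariant_power_bounded (B := (e * k).+1) iI invI Ipk) => IB.
suff /(ideal_pow_leq vR iR R1) : ideal_pow K R (e * k) `<=` ideal_pow K R (e * k).+1.
  by rewrite ltnn.
rewrite ideal_powM -pE ideal_pow_scale -natrX => _ [x Ox <-].
have [_ _ RM] := submodule_pow K R (e * k).+1.
by rewrite mulrC; apply: RM => //; apply: IB.
Qed.

End Powers.
End InvariantIdeals.

(** * Ramification *)

Section Ramification.
Variable N : splittingFieldType rat.
Implicit Types (K L : {subfield N}) (I J P Q : set N) (x y : N) (s t : 'AEnd(N)).

(** Additivity of the P-adic valuation: an element of I outside P I is one that
    has the same valuation at P as I.  Its product with some element of the
    inverse of I is outside P, and P is prime. *)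
Lemma maximal_mul_exact K P I J x y : maximal_ideal K P ->
    invertible_ideal K I -> invertible_ideal K J -> I x -> J y ->
    ~ ideal_mul P I x -> ~ ideal_mul P J y ->
  ~ ideal_mul P (ideal_mul I J) (x * y).
Proof.
move=> Pmax.
have unit_out A z : invertible_ideal K A -> A z -> ~ ideal_mul P A z ->
    exists2 r, ideal_inv K A r & ring_of_integers K (z * r) /\ ~ P (z * r).
  move=> vA Az PAz; have [_ AVA] := invertible_inv vA.
  apply: contrapT => nor; apply: PAz.
  have [Or rP] : (forall r, ideal_inv K A r -> ring_of_integers K (z * r)) /\
      forall r, ideal_inv K A r -> P (z * r).
    have Or r : ideal_inv K A r -> ring_of_integers K (z * r).
      by move=> Ar; rewrite -AVA mulrC; apply: ideal_mul_in.
    split=> // r Ar; apply: contrapT => Pzr; apply: nor; exists r => //.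
    by split=> //; apply: Or.
  have sPA : submodule K (ideal_mul P A) by apply/submodule_mulr/invertible_submodule.
  have : ideal_scale z (ring_of_integers K) z by exists 1; [apply: roi1 | rewrite mulr1].
  rewrite -AVA -ideal_scale_mull; apply: ideal_mul_sub.
  - by case: sPA.
  - by case: sPA.
  - by move=> _ a [r /rP Pzr <-] Aa; apply: ideal_mul_in.
move=> vI vJ Ix Jy PIx PJy Pxy.
have [r Ir [Oxr Pxr]] := unit_out I x vI Ix PIx.
have [u Ju [Oyu Pyu]] := unit_out J y vJ Jy PJy.
have [_ IVI] := invertible_inv vI; have [_ JVJ] := invertible_inv vJ.
suff : P ((x * r) * (y * u)) by move=> /(maximal_prime Pmax Oxr Oyu)[].
have -> : (x * r) * (y * u) = (x * y) * (r * u) by ring.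
have : ideal_mul (ideal_mul P (ideal_mul I J)) (ideal_mul (ideal_inv K I) (ideal_inv K J))
   ((x * y) * (r * u)) by apply: ideal_mul_in => //; apply: ideal_mul_in.
rewrite -ideal_mulA ideal_mulACA ![ideal_mul _ (ideal_inv _ _)]ideal_mulC IVI JVJ.
rewrite ideal_mul_roi ?ideal_mul_roi //; last exact: submodule_roi.
exact: maximal_submodule Pmax.
Qed.

Lemma prod_in_pow K I (A : Type) (r : seq A) (B : pred A) (F : A -> N) :
  (forall i, B i -> I (F i)) -> ideal_pow K I (count B r) (\prod_(i <- r | B i) F i).
Proof.
move=> IF; elim: r => [|i r IHr] /=; first by rewrite big_nil; apply: roi1.
rewrite big_cons; case: ifP => Bi //.
by rewrite add1n ideal_powS; apply: ideal_mul_in => //; apply: IF.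
Qed.

Lemma maximal_prod_exact K P I (A : Type) (r : seq A) (B : pred A) (F : A -> N) :
    maximal_ideal K P -> invertible_ideal K I ->
    (forall i, B i -> I (F i)) -> (forall i, B i -> ~ ideal_mul P I (F i)) ->
  ~ ideal_mul P (ideal_pow K I (count B r)) (\prod_(i <- r | B i) F i).
Proof.
move=> Pmax vI IF PF; elim: r => [|i r IHr] /=.
  rewrite big_nil ideal_mul_roi; first exact: (maximal_neq1 Pmax).
  exact: maximal_submodule.
rewrite big_cons; case: ifP => Bi //; rewrite add1n ideal_powS.
apply: (maximal_mul_exact Pmax vI) => //.
- exact: invertible_pow.
- exact: IF.
- exact: prod_in_pow.
- exact: PF.
Qed.

Variables (K L : {subfield N}).
Hypotheses (KL : (K <= L)%VS) (gK : galois 1%AS K) (gL : galois 1%AS L).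

Lemma galois_over : galois K L.
Proof. by apply: galoisS gL; rewrite KL sub1v. Qed.

Lemma ideal_extend_pow I n :
  ideal_extend L (ideal_pow K I n) = ideal_pow L (ideal_extend L I) n.
Proof.
elim: n => [|n IHn]; first exact: ideal_extend_roi.
by rewrite ideal_powS ideal_extendM IHn.
Qed.

Lemma integral_extend I : integral_ideal K I -> integral_ideal L (ideal_extend L I).
Proof.
move=> [_ IO]; split; first exact/submodule_mulr/submodule_roi.
rewrite -(ideal_extend_roi KL); exact: ideal_mul_mono.
Qed.

Lemma sub_extend I : I `<=` ideal_extend L I.
Proof. by move=> x Ix; rewrite -[x]mulr1; apply: ideal_mul_in => //; apply: roi1. Qed.

Lemma invariant_extend I : invariant I -> invariant (ideal_extend L I).
Proof. by move=> vI; apply: invariant_mul => //; apply: invariant_roi. Qed.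

Variables (p : nat) (p_prime : prime p).
Local Notation RK := (prod_primes_above K p).
Local Notation RL := (prod_primes_above L p).

Let vRL : invertible_ideal L RL := prod_primes_above_invertible gL p_prime.
Let iRL : integral_ideal L RL := prod_primes_above_integral gL p_prime.
Let RL1 : ~ RL 1 := prod_primes_above_neq1 gL p_prime.

(** Weak approximation: a has valuation 1 at all the conjugates of P by
    Gal(L/K), so its norm has the same valuation at P as RL^[L:K]. *)
Lemma exists_norm_exact P : primes_above L p P ->
  exists2 a, RL a & ~ ideal_mul P (ideal_pow L RL #|'Gal(L / K)%g|) (galNorm K L a).
Proof.
move=> PP; have [Pmax Pp] := PP.
have sRL := invertible_submodule vRL.
pose r := [seq gal_repr g @` P | g <- enum 'Gal(L / K)%g].
have rmax : {in r, forall Q, maximal_ideal L Q}.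
  by move=> _ /mapP[g _ ->]; apply: aut_maximal.
have [|a Ra ra] := @maximal_avoidance _ L RL (fun Q => ideal_mul Q RL) r sRL rmax.
  move=> Q rQ; have Qmax := rmax Q rQ; split=> //; first exact: submodule_mulr.
  apply: contrapT => RQR; apply: (maximal_neq1 Qmax).
  suff : ring_of_integers L `<=` Q by apply; apply: roi1.
  apply: (ideal_mul_cancel vRL); [exact: submodule_roi | exact: maximal_submodule |].
  rewrite ideal_mul_roi // ideal_mulC => x Rx.
  by apply: contrapT => Qx; apply: RQR; exists x.
have La : a \in L by have [_ /(_ _ Ra)[]] := iRL.
exists a => //.
rewrite -sum1_card sum1_count; apply: (maximal_prod_exact Pmax vRL).
- by move=> g _; apply: prod_primes_above_aut.
- move=> g Gg PRga; apply: (ra ((g^-1)%g @` P)).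
    by apply/mapP; exists (g^-1)%g; rewrite // mem_enum groupV.
  have -> : a = (g^-1)%g (g a) by rewrite -galM // mulgV gal_id.
  apply: (ideal_mul_sub (S := fun x => ideal_mul ((g^-1)%g @` P) RL ((g^-1)%g x))) PRga.
  + by rewrite rmorph0; apply: ideal_mul0.
  + by move=> x y; rewrite rmorphD; apply: ideal_mulD.
  + move=> x y Px Ry; rewrite rmorphM; apply: ideal_mul_in; first by exists x.
    exact: prod_primes_above_aut.
Qed.

(** The ideal J of K generated by the conjugates of the norms of the elements
    of RL is invariant, so it is a power of RK, and it generates RL^[L:K] in
    L: J lies in RL^[L:K], and some norm does not lie in RL^([L:K] + 1). *)
Theorem ramification : exists e,
  ideal_extend L RK = ideal_pow L RL e /\ (e %| \dim_K L)%N.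
Proof.
have gKL := galois_over.
have iRK := prod_primes_above_integral gK p_prime.
have [e RKe] : exists e, ideal_extend L RK = ideal_pow L RL e.
  apply: (invariant_power gL p_prime (k := 1)).
  - exact: integral_extend.
  - by apply: invariant_extend; apply: prod_primes_above_invariant.
  - by apply: sub_extend; rewrite expn1; apply: prod_primes_above_p.
exists e; split=> //; rewrite galois_dim //; set n := #|_|.
pose norms := [set s (galNorm K L a) | s in [set: 'AEnd(N)] & a in RL].
have ROL : RL `<=` ring_of_integers L by case: iRL.
have norms_roi : norms `<=` ring_of_integers K.
  move=> _ [s _ [a Ra <-]]; apply: aut_roi => //; apply: roi_galNorm => //.
  exact: ROL.
pose J := ideal_mul norms (ring_of_integers K).
have iJ : integral_ideal K J.
  split; first exact/submodule_mulr/submodule_roi.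
  rewrite -[X in _ `<=` X](ideal_mul_roi (submodule_roi K)).
  exact: ideal_mul_mono.
have normsJ : norms `<=` J.
  by move=> x nx; rewrite -[x]mulr1; apply: ideal_mul_in => //; apply: roi1.
have invJ : invariant J.
  apply: invariant_mul; last exact: invariant_roi.
  move=> s _ [t _ [a Ra <-]]; exists (s \o t)%AF => //; exists a => //.
  by rewrite /= lfunE.
have Jp : J (p ^ n)%:R.
  apply: normsJ; exists \1%AF => //; exists p%:R; first exact: prod_primes_above_p.
  rewrite /= id_lfunE /galNorm natrX -prodr_const.
  by apply: eq_bigr => g _; rewrite rmorph_nat.
have [j JE] := invariant_power gK p_prime iJ invJ Jp.
have [m JLE] : exists m, ideal_extend L J = ideal_pow L RL m.
  apply: (invariant_power gL p_prime (k := n)).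
  - exact: integral_extend.
  - exact: invariant_extend.
  - exact: sub_extend.
have mE : m = (e * j)%N.
  apply: (ideal_pow_inj vRL iRL RL1).
  by rewrite -JLE JE ideal_extend_pow RKe ideal_powM.
suff -> : n = m by rewrite mE dvdn_mulr.
apply/eqP; rewrite eqn_leq; apply/andP; split.
  apply: (ideal_pow_leq vRL iRL RL1); rewrite -JLE.
  have [R0 RD RM] := submodule_pow L RL n.
  apply: ideal_mul_sub => // x y Jx Oy; rewrite mulrC; apply: (RM) => //.
  apply: (ideal_mul_sub (S := ideal_pow L RL n)) Jx => // _ z [s _ [a Ra <-]] Oz.
  rewrite mulrC; apply: RM; first exact: roi_sub KL _ Oz.
  apply: invariant_pow => //; first exact: prod_primes_above_invariant.
  rewrite /n -sum1_card sum1_count; apply: prod_in_pow => g _.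
  exact: prod_primes_above_aut.
rewrite leqNgt; apply/negP => ltnm.
have [P PP] := exists_primes_above L p_prime.
have [a Ra] := exists_norm_exact PP; apply.
have JNa : ideal_extend L J (galNorm K L a).
  apply/sub_extend/normsJ; exists \1%AF => //; exists a => //.
  by rewrite /= id_lfunE.
move: JNa; rewrite JLE => /(ideal_pow_anti iRL ltnm).
by apply: ideal_mul_mono => //; apply: prod_primes_above_sub.
Qed.

End Ramification.

(** * Extension of classes *)

Section Classes.
Variable N : splittingFieldType rat.
Implicit Types (K L : {subfield N}) (I J : set N).

Lemma ideal_class_scale K a I : a \in K -> a != 0 ->
  ideal_class K (ideal_scale a I) = ideal_class K I.
Proof.
move=> Ka a0; apply/seteqP; split=> _ [b [Kb b0] <-].
  by exists (b * a); rewrite ?ideal_scaleA //; split; [rewrite rpredM | rewrite mulf_neq0].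
exists (b / a); first by split; [rewrite rpred_div | rewrite mulf_neq0 ?invr_eq0].
by rewrite ideal_scaleA divfK.
Qed.

Lemma class_of_eq K (I J : set N) (hI : invertible_ideal K I) (hJ : invertible_ideal K J) :
  I = J -> class_of hI = class_of hJ.
Proof. by move=> IJ; apply: class_inj; rewrite /= IJ. Qed.

Lemma class_of_mem K (c : class_group K) I (hI : invertible_ideal K I) :
  class_set c I -> c = class_of hI.
Proof.
have [J _ cJ] := class_setP c; rewrite cJ => -[a [Ka a0] aJ].
by apply: class_inj; rewrite cJ /= -aJ ideal_class_scale.
Qed.

Lemma class_ofE K (c : class_group K) :
  exists I, exists hI : invertible_ideal K I, c = class_of hI.
Proof.
have [I hI cI] := class_setP c; exists I, hI; apply: class_of_mem.
by rewrite cI; apply: ideal_class_refl.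
Qed.

Lemma class_of_eq0 K I (hI : invertible_ideal K I) :
  class_of hI = 0 <->
  exists2 a, a \in K /\ a != 0 & I = ideal_scale a (ring_of_integers K).
Proof.
split=> [/(congr1 (@class_set _ _)) /= cI|[a [Ka a0] IE]].
  by have := ideal_class_refl K I; rewrite cI => -[a aK <-]; exists a.
by apply: class_inj; rewrite /= IE ideal_class_scale.
Qed.

Lemma class_of_mulrn K I (hI : invertible_ideal K I) n :
  class_of hI *+ n = class_of (invertible_pow n hI).
Proof.
elim: n => [|n IHn]; first by rewrite mulr0n; apply: class_of_eq.
by rewrite mulrS IHn; apply: class_inj; apply: class_addE.
Qed.

(** If I O_L = a O_L, the conjugates of a over K also generate I O_L, so that
    I^[L:K] O_L is generated by the norm b of a, which lies in K; as I is
    invertible, its power I^[L:K] is then generated by b in K. *)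
Lemma class_extend_kernel K L (KL : (K <= L)%VS) (c : class_group K) :
  galois 1%AS L -> class_extend KL c = 0 -> c *+ \dim_K L = 0.
Proof.
move=> gL; have gKL := galois_over KL gL.
have [I [hI ->]] := class_ofE c; rewrite class_extend_of.
move=> /class_of_eq0[a [La a0] IL]; rewrite class_of_mulrn galois_dim //.
set n := #|_|; apply/class_of_eq0; pose b := galNorm K L a.
have Kb : b \in K by apply: mem_galNorm.
have b0 : b != 0 by rewrite galNorm_eq0.
exists b => //; have hIn := invertible_pow n hI.
have InL : ideal_extend L (ideal_pow K I n) = ideal_scale b (ring_of_integers L).
  rewrite ideal_extend_pow // IL /b /galNorm /n -sum1_card sum1_count.
  elim: (index_enum _) => [|g r IHr] /=; first by rewrite big_nil ideal_scale1.
  rewrite big_cons; case: ifP => Gg //; rewrite add1n ideal_powS IHr.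
  (* The automorphism g fixes I, hence stabilizes I O_L = a O_L. *)
  suff <- : ideal_scale (g a) (ring_of_integers L) = ideal_scale a (ring_of_integers L).
    by rewrite ideal_scale_mul ideal_mul_roi //; apply: submodule_roi.
  have scale_im : ideal_scale (g a) (ring_of_integers L) =
      g @` (ideal_scale a (ring_of_integers L)).
    rewrite -{1}(aut_image_roi g gL); apply/seteqP.
    by split=> [_ [_ [x Ox <-] <-]|_ [_ [x Ox <-] <-]];
      [exists (a * x); rewrite ?rmorphM //; exists x
      |exists (g x); rewrite ?rmorphM //; exists x].
  have IK : I `<=` [set x | x \in K] by case: hI => -[].
  have fixI x : I x -> g x = x by move=> /IK /(fixed_gal KL Gg).
  rewrite scale_im -IL; apply/seteqP; split.
    move=> _ [x + <-]; apply: (ideal_mul_sub (S := fun x => ideal_extend L I (g x))).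
    - by rewrite rmorph0; apply: ideal_mul0.
    - by move=> y z; rewrite rmorphD; apply: ideal_mulD.
    - move=> y z Iy Oz; rewrite rmorphM /= fixI //.
      by apply: ideal_mul_in => //; apply: aut_roi.
  have [t [gt tg]] := aut_inverse g.
  move=> x Ix; exists (t x); rewrite ?tg //; move: x Ix.
  apply: (ideal_mul_sub (S := fun x => ideal_extend L I (t x))).
  - by rewrite rmorph0; apply: ideal_mul0.
  - by move=> y z; rewrite rmorphD; apply: ideal_mulD.
  - move=> y z Iy Oz; rewrite rmorphM /= -[in X in t X](fixI _ Iy) gt.
    by apply: ideal_mul_in => //; apply: aut_roi.
have KIn : ideal_pow K I n `<=` [set x | x \in K] by case: hIn => -[].
apply/seteqP; split=> x.
  move=> Inx; have : ideal_extend L (ideal_pow K I n) x by apply: sub_extend.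
  rewrite InL => -[y [Ly iy] byx]; exists y => //; split=> //.
  by rewrite -(mulKf b0 y) byx rpredM ?rpredV //; apply: KIn.
have [hJ JI] := invertible_inv hIn; set J := ideal_inv K _ in hJ JI.
have sIn := invertible_submodule hIn.
have bJ : ideal_scale b J `<=` ring_of_integers K.
  move=> _ [z Jz <-]; split; first by rewrite rpredM //; case: Jz.
  suff [] : ring_of_integers L (b * z) by [].
  rewrite -(ideal_extend_roi KL) -JI ideal_extendM // InL.
  rewrite ideal_scale_mulr ideal_mul_roi; last exact/submodule_mulr/submodule_roi.
  by exists z => //; apply: sub_extend.
move=> [y Oy <-]; rewrite mulrC; have [_ _] := sIn; apply=> //.
rewrite -(ideal_roi_mul sIn); apply: (ideal_mul_mono bJ (@subset_refl _ _)).
by rewrite ideal_scale_mull JI; exists 1; [apply: roi1 | rewrite mulr1].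
Qed.

End Classes.

(** * The Polya group of a Galois field *)

Section PolyaGroup.
Variable N : splittingFieldType rat.
Implicit Types (K L : {subfield N}) (p : nat).

Lemma polya_group_subgroup K : subgroup (polya_group K).
Proof. exact: generated_subgroup_subgroup. Qed.

Definition polya_class K p (gK : galois 1%AS K) (pp : prime p) : class_group K :=
  class_of (prod_primes_above_invertible gK pp).

Lemma Pi_ideal_above K p q :
    [set P | maximal_ideal K P /\ has_norm K P q] = primes_above K p ->
  Pi_ideal K q = prod_primes_above K p.
Proof. by rewrite /Pi_ideal => ->. Qed.

Lemma mem_polya_class K p (gK : galois 1%AS K) (pp : prime p) :
  polya_group K (polya_class gK pp).
Proof.
move=> S [_]; apply; have [q q0 /Pi_ideal_above qE] := primes_above_norm gK pp.
by exists q => //; rewrite qE; apply: ideal_class_refl.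
Qed.

Lemma polya_group_sub K (gK : galois 1%AS K) (S : set (class_group K)) :
  subgroup S -> (forall p (pp : prime p), S (polya_class gK pp)) ->
  polya_group K `<=` S.
Proof.
move=> gS Sp; apply: generated_subgroup_sub => // c [q q0 cq].
have [E|[p pp /Pi_ideal_above qE]] := norm_primes_above gK q; last first.
  rewrite qE in cq; rewrite (class_of_mem (prod_primes_above_invertible gK pp) cq).
  exact: Sp.
move: cq; rewrite /Pi_ideal E fset_set0 (size0nil (cardfs0 _)) big_nil.
by move=> /(class_of_mem (invertible_roi K)) ->; case: gS.
Qed.

Lemma class_extend_polya K L (KL : (K <= L)%VS) (gK : galois 1%AS K)
    (gL : galois 1%AS L) p (pp : prime p) : exists e, (e %| \dim_K L)%N /\
  class_extend KL (polya_class gK pp) = polya_class gL pp *+ e.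
Proof.
have [e [RE eL]] := ramification KL gK gL pp; exists e; split=> //.
by rewrite class_extend_of class_of_mulrn; apply: class_of_eq.
Qed.

Lemma polya_field_class K p (gK : galois 1%AS K) (pp : prime p) :
  polya_field K -> polya_class gK pp = 0.
Proof.
move=> polyaK; have [q q0 /Pi_ideal_above qE] := primes_above_norm gK pp.
have [a [Ka _] aE] := polyaK q q0; apply/class_of_eq0; exists a; last by rewrite -qE.
split=> //; have := prod_primes_above_p gK pp; rewrite -qE aE => -[x _ axp].
have : p%:R != 0 :> N by rewrite natrN_neq0 // prime_gt0.
by rewrite -axp mulf_eq0 => /norP[].
Qed.

Lemma polya_group_killed K L (KL : (K <= L)%VS) (gK : galois 1%AS K)
    (gL : galois 1%AS L) (c : class_group L) :
  polya_field K -> polya_group L c -> c *+ \dim_K L = 0.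
Proof.
move=> polyaK.
suff : polya_group L `<=` [set c | c *+ \dim_K L = 0] by apply.
apply: (polya_group_sub (gK := gL)); first exact: mulrn_subgroup.
move=> p pp /=.
have [e [/dvdnP[k ->] cE]] := class_extend_polya KL gK gL pp.
rewrite mulnC mulrnA -cE polya_field_class //.
by rewrite (additive_map0 (class_extendD KL)) mul0rn.
Qed.

Lemma class_extend_polya_group K L (KL : (K <= L)%VS) (c : class_group K) :
  galois 1%AS K -> galois 1%AS L -> polya_group K c -> polya_group L (class_extend KL c).
Proof.
move=> gK gL.
suff : polya_group K `<=` class_extend KL @^-1` polya_group L by apply.
apply: (polya_group_sub (gK := gK)).
  exact: (preimage_subgroup (class_extendD KL) (polya_group_subgroup L)).
move=> p pp /=; have [e [_ ->]] := class_extend_polya KL gK gL pp.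
rewrite pmulrn; apply: (subgroup_mulrz _ (polya_group_subgroup L)).
exact: mem_polya_class.
Qed.

End PolyaGroup.

(** * The compositum of K1 and K2 *)

Section Degrees.
Variable N : splittingFieldType rat.
Implicit Types (K L M : {subfield N}).

Lemma galois_cap K L M : K = (L :&: M)%AS -> galois 1%AS L -> galois 1%AS M -> galois 1%AS K.
Proof.
move=> -> gL gM; have /and3P[_ /separableP sL _] := gL.
apply/and3P; split; first exact: sub1v.
  by apply/separableP => x; rewrite memv_cap => /andP[/sL].
apply/'forall_implyP => s _; rewrite /= lker0_img_cap; last first.
  exact: kAutf_lker0 (k1AHom fullv s).
by rewrite !aut_normal.
Qed.

Lemma galois_prodv K L M : K = (L * M)%AS -> galois 1%AS L -> galois 1%AS M -> galois 1%AS K.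
Proof.
move=> -> gL gM; apply/and3P; split; first exact: sub1v.
  apply/separableP => x _; apply: pcharf0_separable => p; rewrite [RHS]inE.
  apply/negP => /andP[/prime_gt0 p_gt0]; exact/negP/natrN_neq0.
by apply/'forall_implyP => s _; rewrite aimgM !aut_normal.
Qed.

(** Gal(L/K1) meets Gal(L/K2) trivially as K1 and K2 generate L; so the order
    of Gal(L/K0) is a multiple of the product of their orders. *)
Lemma dim_compositum_dvdn K0 K1 K2 L :
  L = (K1 * K2)%AS -> (K0 <= K1)%VS -> (K0 <= K2)%VS ->
  galois 1%AS L -> galois 1%AS K2 -> (\dim_K1 L %| \dim_K0 K2)%N.
Proof.
move=> LE K01 K02 gL g2.
have K1L : (K1 <= L)%VS by rewrite LE; apply: field_subvMr.
have K2L : (K2 <= L)%VS by rewrite LE; apply: field_subvMl.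
have K0L := subv_trans K02 K2L.
have over K : (K <= L)%VS -> galois K L by move=> KL; apply: galoisS gL; rewrite KL sub1v.
have nH2 : ('Gal(L / K2) <| 'Gal(L / K0))%g.
  have /and3P[_ _ nK02] : galois K0 K2 by apply: galoisS g2; rewrite K02 sub1v.
  by apply: normalField_normal; rewrite ?over ?K02.
have tI : ('Gal(L / K1) :&: 'Gal(L / K2))%g = 1%g.
  apply/trivgP/fintype.subsetP => s /setIP[s1 s2]; rewrite inE; apply/gal_eqP => x Lx.
  suff /subvP/(_ x Lx)/fixedSpaceP sx : (L <= fixedSpace s)%VS by rewrite sx gal_id.
  have LV : L = (K1 * K2)%VS :> {vspace N} by rewrite LE.
  rewrite [X in (X <= _)%VS]LV; apply/prodvP => u v K1u K2v; apply/fixedSpaceP.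
  by rewrite rmorphM /= (fixed_gal K1L s1) ?(fixed_gal K2L s2).
have : (#|'Gal(L / K1)%g| * #|'Gal(L / K2)%g| %| #|'Gal(L / K0)%g|)%N.
  rewrite -TI_cardMg // -norm_joinEl ?cardSg ?join_subG ?galS //.
  exact: fintype.subset_trans (galS _ K01) (normal_norm nH2).
rewrite -!galois_dim ?over //.
have dimL : (\dim_K0 L = \dim_K0 K2 * \dim_K2 L)%N.
  apply/eqP; rewrite -(eqn_pmul2r (adim_gt0 K0)) -dim_sup_field //.
  by rewrite mulnAC -dim_sup_field // mulnC -dim_sup_field.
by rewrite dimL dvdn_pmul2r // divn_gt0 ?adim_gt0 // dimvS.
Qed.

End Degrees.


Theorem theorem3p7 (N : splittingFieldType rat) (K1 K2 K0 L : {subfield N})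
    (defK0 : K0 = (K1 :&: K2)%AS) (defL : L = (K1 * K2)%AS)
    (K1L : (K1 <= L)%VS) (K2L : (K2 <= L)%VS)
    (galK1 : galois 1%AS K1) (galK2 : galois 1%AS K2)
    (polyaK0 : polya_field K0)
    (coprime_deg : gcdn (\dim_K0 K1) (\dim_K0 K2) = 1%N) :
  subgroup_isomorphic (polya_group L) (polya_group K1 `*` polya_group K2) /\
  internal_direct_sum (polya_group L)
    (class_extend K1L @` polya_group K1) (class_extend K2L @` polya_group K2).
Proof.
have galK0 := galois_cap defK0 galK1 galK2.
have galL := galois_prodv defL galK1 galK2.
have K01 : (K0 <= K1)%VS by rewrite defK0 capvSl.
have K02 : (K0 <= K2)%VS by rewrite defK0 capvSr.
have deg1 := dim_compositum_dvdn defL K01 K02 galL galK2.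
have deg2 : (\dim_K2 L %| \dim_K0 K1)%N.
  apply: (dim_compositum_dvdn _ K02 K01 galL galK1).
  by rewrite defL; apply/val_inj; rewrite /= prodvC.
have cop : coprime (\dim_K0 K1) (\dim_K0 K2) by apply/eqP.
have killed (K M : {subfield N}) (KM : (K <= M)%VS) d :
    (\dim_K M %| d)%N -> forall c, class_extend KM c = 0 ->
    galois 1%AS M -> c *+ d = 0.
  move=> /dvdnP[k ->] c c0 gM.
  by rewrite mulnC mulrnA (class_extend_kernel gM c0) mul0rn.
have sub1 := image_subgroup (class_extendD K1L) (polya_group_subgroup K1).
have sub2 := image_subgroup (class_extendD K2L) (polya_group_subgroup K2).
have -> : polya_group L = [set x + y | x in class_extend K1L @` polya_group K1
                                     & y in class_extend K2L @` polya_group K2].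
  apply/seteqP; split; last first.
    move=> _ [_ [x P1x <-] [_ [y P2y <-] <-]].
    by apply: (subgroupD (polya_group_subgroup L)); apply: class_extend_polya_group.
  have sub12 := subgroup_add sub1 sub2.
  apply: (polya_group_sub (gK := galL) sub12) => p pp.
  have [e1 [e1d E1]] := class_extend_polya K1L galK1 galL pp.
  have [e2 [e2d E2]] := class_extend_polya K2L galK2 galL pp.
  (* So the multiples of the class by e1 and e2 are enough to recover it. *)
  have cope : coprime e1 e2.
    rewrite coprime_sym in cop; apply: coprime_dvdl (dvdn_trans e1d deg1) _.
    exact: coprime_dvdr (dvdn_trans e2d deg2) cop.
  apply: (subgroup_coprime sub12 cope).
  - rewrite -E1; exists (class_extend K1L (polya_class galK1 pp)).
      by exists (polya_class galK1 pp) => //; apply: mem_polya_class.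
    by exists 0; [apply: subgroup0 | rewrite addr0].
  - rewrite -E2; exists 0; first exact: subgroup0.
    exists (class_extend K2L (polya_class galK2 pp)); last by rewrite add0r.
    by exists (polya_class galK2 pp) => //; apply: mem_polya_class.
apply: (@coprime_direct_sum _ _ _ _ _ _ _ (\dim_K0 K1) (\dim_K0 K2)).
- exact: class_extendD.
- exact: class_extendD.
- exact: polya_group_subgroup.
- exact: polya_group_subgroup.
- exact: cop.
- by move=> c; apply: polya_group_killed.
- by move=> c; apply: polya_group_killed.
- by move=> c c0; apply: killed c0 galL.
- by move=> c c0; apply: killed c0 galL.
Qed.
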